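(* Consider a cRKDG method with Butcher coefficients $(a_{ij})$ (strictly lower triangular) and $(b_i)$, $1\le i,j\le s$. Suppose that, without using limiters, each of its stages (the inner stages $u_h^{(i)}$ and the final stage $u_h^{n+1}$) can be written as a convex combination of forward-Euler steps from previous stages of the three types $$u_h^{(j)}+\Delta t\,\mu_{ij}^{\mathcal F}\,\mathcal F(u_h^{(j)}),\qquad u_h^{(j)}+\Delta t\,\mu_{ij}^{+\mathcal G}\,\mathcal G(u_h^{(j)}),\qquad u_h^{(j)}-\Delta t\,\mu_{ij}^{-\mathcal G}\,\mathcal G(u_h^{(j)}),$$ with $j<i$ and all $\mu_{ij}^{\mathcal F},\mu_{ij}^{\pm\mathcal G}>0$ (the final stage being indexed by $i=s+1$, with $u_h^{(s+1)}:=u_h^{n+1}$). Assume the CFL condition $$\lambda a_0\le \min_{i,j}\left(\frac{c_{\mathcal F}}{\mu_{ij}^{\mathcal F}},\ \frac{c_{\mathcal G}}{\mu_{ij}^{\pm\mathcal G}}\right),$$ the minimum being over all the steps that occur. If the corresponding scaling limiter is applied after each RK stage, then $$u_h^n\in B \text{ on } S_K \text{ for all } K\quad\Longrightarrow\quad u_h^{n+1}\in B\text{ on } S_K\text{ for all }K,$$ where $u_h^n$ and $u_h^{n+1}$ denote the limited numerical solutions at the two time levels.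
   Context: Equation: $\partial_t u+\nabla\cdot f(u)=0$ on $\Omega\subset\mathbb R^d$, $u$ with values in $\mathbb R^m$, $C^1$ flux $f=[f_1,\dots,f_d]$ with values in $\mathbb R^{m\times d}$; $B$ is a convex invariant region. Mesh and space: $\mathcal T_h=\{K\}$ is a mesh of $\Omega$; each cell $K$ has flat edges $e_{\ell,K}$, $\ell=1,\dots,l(K)$, with constant unit outer normals $\nu_{\ell,K}$ ($|e_{\ell,K}|:=1$ if $d=1$). $V_h=\{v\in L^2(\Omega): v|_K\in[Z^k(K)]^m\ \forall K\}$, where $k\ge 1$ and $Z^k(K)$ is the space of polynomials of total degree $\le k$, or of degree $\le k$ in each variable. $v^{\rm int},v^{\rm ext}$ are the interior and exterior traces on $e_{\ell,K}$; $\overline v_K$ is the cell average on $K$. Quadrature: edge integrals are replaced by $\int_{e_{\ell,K}}v\,dl\approx |e_{\ell,K}|\sum_{\beta=1}^{s_\ell}\omega^{\rm B}_{\beta,\ell,K}v(x_{\beta,\ell,K})$ with $\omega^{\rm B}_{\beta,\ell,K}>0$, $\sum_\beta\omega^{\rm B}_{\beta,\ell,K}=1$. There is a convex decomposition, valid for all $v\in Z^k(K)$: $\overline v_K=\sum_{\alpha=1}^{s_K}\omega^{\rm I}_{\alpha,K}v(x_{\alpha,K})+\sum_{\ell=1}^{l(K)}\sum_{\beta=1}^{s_\ell}\omega^{\rm I}_{\beta,\ell,K}v(x_{\beta,\ell,K})$ with all weights in $(0,1)$ (hence summing to 1). $S_K=\{x_{\alpha,K},x_{\beta,\ell,K}\}$.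 ''$u_h\in B$ on $S_K$'' means $u_h(x_{\alpha,K})\in B$ and $u_h^{\rm int}(x_{\beta,\ell,K})\in B$ for all $\alpha,\beta,\ell$; ''$u_h\in B$ on $\overline S_K$'' means in addition $u_h^{\rm ext}(x_{\beta,\ell,K})\in B$ for all $\beta,\ell$. Operators (every edge integral $\int_{e_{\ell,K}}v\,dl$ being computed by the quadrature rule $|e_{\ell,K}|\sum_{\beta=1}^{s_\ell}\omega^{\rm B}_{\beta,\ell,K}v(x_{\beta,\ell,K})$): $\mathcal F(u_h)=-\nabla^{\rm DG}\cdot f(u_h)\in V_h$ and $\mathcal G(u_h)=-\nabla^{\rm loc}\cdot f(u_h)\in V_h$, where for all $v_h\in V_h$, $\int_K[\nabla^{\rm DG}\cdot f(u_h)]\cdot v_h\,dx=-\int_K f(u_h):\nabla v_h\,dx+\sum_\ell\int_{e_{\ell,K}}\widehat{f\cdot\nu_{\ell,K}}(u_h^{\rm int},u_h^{\rm ext})\cdot v_h\,dl$ with a numerical flux (e.g. Lax–Friedrichs: $\frac{f(u_h^{\rm int})+f(u_h^{\rm ext})}{2}\cdot\nu_{\ell,K}-\frac{\alpha_{\ell,K}}2(u_h^{\rm ext}-u_h^{\rm int})$, $\alpha_{\ell,K}=\max|\mathrm{eig}(\partial_uf\cdot\nu_{\ell,K})|$), and $\int_K[\nabla^{\rm loc}\cdot f(u_h)]\cdot v_h\,dx$ is given by the same formula with $\widehat{f\cdot\nu_{\ell,K}}$ replaced by $f(u_h^{\rm int})\cdot\nu_{\ell,K}$. Constants: $\lambda=\max_{\ell,K}\Delta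 t\,|e_{\ell,K}|/|K|$; $a_0=\max|\mathrm{eig}(\partial_uf(u)\cdot\nu_{\ell,K})|>0$, the maximum over all $\ell,K$ and over the relevant states $u$ (all $u\in B=[m,M]$ for scalar laws; all values of the numerical solutions involved for systems); $c_{\mathcal G}=\min_{\beta,\ell,K}\omega^{\rm I}_{\beta,\ell,K}/\omega^{\rm B}_{\beta,\ell,K}$. Problems covered: (a) scalar conservation laws with $B=[m,M]$, in 1D or 2D on Cartesian or triangular meshes; (b) the compressible Euler equations, $u=(\rho,m^\top,E)^\top$, $f(u)=(m;\ \frac1\rho m\otimes m+pI_d;\ (E+p)\frac m\rho)$, $p=(\gamma-1)(E-\frac{|m|^2}{2\rho})$, $\gamma>1$, $B=\{\rho>0,\ p>0\}$, on the same meshes; (c) other hyperbolic systems with convex $B$ having the Lax–Friedrichs splitting property ($u\in B$, $\nu$ unit, $a>0$ with $a\ge\max|\mathrm{eig}(\partial_uf(u)\cdot\nu)|$ imply $u\pm a^{-1}f(u)\cdot\nu\in B$) and the weak property for $\mathcal F$ stated next. In all cases $c_{\mathcal F}>0$ is a constant for which the following (known for (a), (b)) holds: if $\lambda a_0\le c_{\mathcal F}$ and $u_h\in B$ on $\overline S_K$, then $\overline{u_h+\Delta t\,\mathcal F(u_h)}_K\in B$. cRKDG method (without limiters): $u_h^{(i)}=u_h^n+\Delta t\sum_{j=1}^{i-1}a_{ij}\mathcal G(u_h^{(j)})$, $i=1,\dots,s$; $u_h^{n+1}=u_h^n+\Delta t\sum_{i=1}^s b_i\mathcal F(u_h^{(i)})$.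 ''Can be written as a convex combination'' (for $i\ge2$; $u_h^{(1)}=u_h^n$) means as a formal identity in the symbols $u_h^n,\mathcal G(u_h^{(j)}),\mathcal F(u_h^{(j)})$ obtained by substituting these defining formulas. With limiters: with $\tilde u_h^n$ the limited solution at time $n$, $u_h^{(i)}=\tilde u_h^n+\Delta t\sum_{j<i}a_{ij}\mathcal G(\tilde u_h^{(j)})$, $\tilde u_h^{(i)}=\mathcal L(u_h^{(i)})$, $u_h^{n+1}=\tilde u_h^n+\Delta t\sum_i b_i\mathcal F(\tilde u_h^{(i)})$, $\tilde u_h^{n+1}=\mathcal L(u_h^{n+1})$. The claim concerns $\tilde u_h^n$ and $\tilde u_h^{n+1}$. Scaling limiter $\mathcal L$: acts cell by cell, preserves cell averages, and whenever the cell average on $K$ lies in $B$, the output lies in $B$ on $S_K$. Scalar case: $p_K\mapsto\theta(p_K-\overline u_K)+\overline u_K$, $\theta=\min\{|\frac{M-\overline u_K}{M_K-\overline u_K}|,|\frac{m-\overline u_K}{m_K-\overline u_K}|,1\}$, $M_K=\max_{S_K}p_K$, $m_K=\min_{S_K}p_K$ (quotients with zero denominator are ignored). Euler case, with $\epsilon>0$ small enough that $\overline\rho_K\ge\epsilon$ and $\overline E_K-\frac{|\overline m_K|^2}{2\overline\rho_K}\ge\epsilon$ for the cell averages: first $\widehat\rho_K=\theta_1(\rho_K-\overline\rho_K)+\overline\rho_K$, $\theta_1=\min\{1,\frac{\overline\rho_K-\epsilon}{\overline\rho_K-\min_{S_K}\rho_K}\}$; then, with $\widehat u_K=(\widehat\rho_K,m_K^\top,E_K)^\top$,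 $\widetilde u_K=\theta_2(\widehat u_K-\overline u_K)+\overline u_K$, $\theta_2=\min\{1,\frac{\overline{\rho e}_K-\epsilon}{\overline{\rho e}_K-\min_{S_K}\rho e_K}\}$, $\overline{\rho e}_K=\overline E_K-\frac{|\overline m_K|^2}{2\overline\rho_K}$, $\rho e_K=E_K-\frac{|m_K|^2}{2\widehat\rho_K}$ (same convention on zero denominators). *)

(* Defs.v *)
From HB Require Import structures.
From mathcomp Require Import all_boot all_order all_algebra.
From mathcomp Require Import all_classical all_reals all_analysis.
From mathcomp.multinomials Require mpoly.
(* The notations of mpoly clash with those of the analysis library: only its
   instances are imported, and its operations are used qualified. *)
Import (canonicals, coercions) mpoly.

Set Implicit Arguments.
Unset Strict Implicit.
Unset Printing Implicit Defensive.

Import Order.TTheory GRing.Theory Num.Theory.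
Import numFieldNormedType.Exports.

Local Open Scope classical_set_scope.
Local Open Scope ring_scope.

Section lebesgue_Rd.
Context {R : realType}.

Definition cons_pair d (x : d.-tuple (measurableTypeR R) * measurableTypeR R) :
  d.+1.-tuple (measurableTypeR R) := [tuple of x.2 :: x.1].

Lemma measurable_cons_pair d : measurable_fun setT (@cons_pair d).
Proof. by apply: measurable_cons; [exact: measurable_snd | exact: measurable_fst]. Qed.

Definition lebesgue_tuple_step d
    (mu : {measure set (d.-tuple (measurableTypeR R)) -> \bar R}) :
    {measure set (d.+1.-tuple (measurableTypeR R)) -> \bar R} :=
  let lam := lebesgue_measure :
    {sigma_finite_measure set (measurableTypeR R) -> \bar R} in
  measure_function_pushforward__canonical__measure_function_Measure
    [the {measure set _ -> \bar R} of (mu \x lam)%E]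
    (@measurable_cons_pair d).

(* Lebesgue measure on R^d, d = 0 included (a unit mass). *)
Fixpoint lebesgue_tuple d :
    {measure set (d.-tuple (measurableTypeR R)) -> \bar R} :=
  match d with
  | 0%N => [the {measure set _ -> \bar R} of
             dirac (nil_tuple (measurableTypeR R))]
  | d'.+1 => lebesgue_tuple_step (lebesgue_tuple d')
  end.

(* Geometry lives in 'rV[R]_d, measure theory on d-tuples. *)
Definition point_of d (t : d.-tuple (measurableTypeR R)) : 'rV[R]_d :=
  \row_i tnth t i.

Definition vol d (A : set 'rV[R]_d) : \bar R :=
  lebesgue_tuple d (@point_of d @^-1` A).

Definition integral_on d (A : set 'rV[R]_d) (g : 'rV[R]_d -> R) : R :=
  \int[lebesgue_tuple d]_(t in @point_of d @^-1` A) g (point_of t).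

Definition dotv n (x y : 'rV[R]_n) : R := \sum_i x 0 i * y 0 i.

Definition is_max (A : set R) (a : R) : Prop := A a /\ ubound A a.

End lebesgue_Rd.

Section mesh.
Context {R : realType}.

(* The edges e_{l,K}, l = 1..l(K), of all cells form the finite type [edge], with
   [owner e] the cell K of e; an edge shared by two cells therefore occurs twice,
   once for each side.
   [chart_origin e + y *m chart_frame e], y in R^(d-1), is an isometric
   parametrization of the hyperplane of e; it serves to measure e.
   [nbr e] is the same edge seen from the cell across it. [shift e] is 0 except for a
   periodic identification of two boundary edges, where it is the period; edges
   with [nbr e = None] are those where exterior states come from boundary data. *)
Record mesh (d : nat) := Mesh {
  domain : set 'rV[R]_d;
  cell : finType;
  edge : finType;
  owner : edge -> cell;
  body : cell -> set 'rV[R]_d;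
  face : edge -> set 'rV[R]_d;
  normal : edge -> 'rV[R]_d;
  chart_origin : edge -> 'rV[R]_d;
  chart_frame : edge -> 'M[R]_(d.-1, d);
  nbr : edge -> option edge;
  shift : edge -> 'rV[R]_d;
  in_chart (e : edge) : set 'rV[R]_d -> set 'rV[R]_d.-1 :=
    fun A => [set y | A (chart_origin e + y *m chart_frame e)];
  open_domain : open domain;
  domain_cover : closure domain = \bigcup_(K in [set: cell]) body K;
  body_disjoint : forall K K', K != K' -> (body K)° `&` (body K')° = set0;
  body_compact : forall K, compact (body K);
  body_regclosed : forall K, regclosed (body K);
  body_measurable : forall K, measurable (@point_of R d @^-1` body K);
  body_vol : forall K, (0 < vol (body K) < +oo)%E;
  body_boundary : forall K,
    body K `\` (body K)° = \bigcup_(e in [set e | owner e = K]) face e;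
  face_compact : forall e, compact (face e);
  face_flat : forall e,
    face e `<=` [set chart_origin e + y *m chart_frame e | y in [set: 'rV_d.-1]];
  face_area : forall e, (0 < vol (in_chart e (face e)) < +oo)%E;
  face_overlap : forall e e', e != e' -> owner e = owner e' ->
    vol (in_chart e (face e `&` face e')) = 0%E;
  frame_isometric : forall e, chart_frame e *m (chart_frame e)^T = 1%:M;
  frame_normal : forall e, chart_frame e *m (normal e)^T = 0;
  normal_unit : forall e, dotv (normal e) (normal e) = 1;
  normal_outer : forall e x, face e x ->
    (forall e', e' != e -> owner e' = owner e -> ~ face e' x) ->
    \forall t \near 0^'+, body (owner e) (x - t *: normal e) /\
                          ~ body (owner e) (x + t *: normal e);
  nbr_neq : forall e, nbr e <> Some e;
  nbr_sym : forall e e', nbr e = Some e' -> nbr e' = Some e;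
  shift_sym : forall e e', nbr e = Some e' -> shift e' = - shift e;
  nbr_normal : forall e e', nbr e = Some e' -> normal e' = - normal e;
  nbr_face : forall e e', nbr e = Some e' ->
    face e' = [set x + shift e | x in face e];
  nbr_boundary : forall e, nbr e = None \/ shift e != 0 ->
    face e `<=` closure domain `\` domain
}.

Definition cell_vol d (M : mesh d) (K : cell M) : R := fine (vol (body K)).

Definition edge_len d (M : mesh d) (e : edge M) : R :=
  fine (vol (in_chart e (face e))).

(* Intervals for d = 1, axis-parallel rectangles for d = 2. *)
Definition box_cell d (M : mesh d) (K : cell M) : Prop :=
  exists (lo hi : 'rV[R]_d) (phi : 'I_d * bool -> edge M),
  [/\ forall i, lo 0 i < hi 0 i,
      body K = [set x | forall i, lo 0 i <= x 0 i <= hi 0 i],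
      injective phi,
      forall e, owner e = K <-> exists ib, e = phi ib &
      forall ib, face (phi ib) =
        body K `&` [set x | x 0 ib.1 = if ib.2 then hi 0 ib.1 else lo 0 ib.1]].

(* Triangles for d = 2. *)
Definition simplex_cell d (M : mesh d) (K : cell M) : Prop :=
  exists (v : 'I_d.+1 -> 'rV[R]_d) (phi : 'I_d.+1 -> edge M),
  let hull (J : pred 'I_d.+1) := [set x | exists c : 'I_d.+1 -> R,
    [/\ forall i, 0 <= c i, forall i, ~~ J i -> c i = 0,
        \sum_i c i = 1 & x = \sum_i c i *: v i]] in
  [/\ row_free (\matrix_(i < d) (v (lift ord0 i) - v ord0)),
      body K = hull predT,
      injective phi,
      forall e, owner e = K <-> exists i, e = phi i &
      forall i, face (phi i) = hull (predC1 i)].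

Definition low_dim_mesh d (M : mesh d) : Prop :=
  (d = 1%N /\ forall K : cell M, box_cell K) \/
  (d = 2%N /\ ((forall K : cell M, box_cell K) \/
               (forall K : cell M, simplex_cell K))).

End mesh.
Arguments mesh : clear implicits.

Inductive poly_kind := total_degree | partial_degree.

Section dg.
Context {R : realType} {d : nat}.
Implicit Types (M : mesh R d) (p : mpoly.mpoly d R).

Definition peval p (x : 'rV[R]_d) : R := mpoly.meval (fun i => x 0 i) p.

Definition poly_space (kd : poly_kind) (k : nat) p : Prop :=
  match kd with
  | total_degree => (mpoly.msize p <= k.+1)%N
  | partial_degree => forall mm, mm \in mpoly.msupp p ->
                        forall i : 'I_d, (mm i <= k)%N
  end.

Definition pavg M (K : cell M) p : R :=
  (cell_vol K)^-1 * integral_on (body K) (peval p).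

(* The nodes x_{alpha,K} are [xI], the nodes x_{beta,l,K} are [xE]; two cells that
   share an edge use the same nodes on it. *)
Record quadrature M (kd : poly_kind) (k : nat) := Quadrature {
  nI : cell M -> nat;
  nE : edge M -> nat;
  xI : forall K, 'I_(nI K) -> 'rV[R]_d;
  xE : forall e, 'I_(nE e) -> 'rV[R]_d;
  wI : forall K, 'I_(nI K) -> R;
  wE : forall e, 'I_(nE e) -> R;
  wB : forall e, 'I_(nE e) -> R;
  xI_body : forall K al, body K (@xI K al);
  xE_face : forall e be, face e (@xE e be);
  xE_nbr : forall e e', nbr e = Some e' ->
    forall be, exists be', @xE e' be' = @xE e be + shift e;
  wI_01 : forall K al, 0 < @wI K al < 1;
  wE_01 : forall e be, 0 < @wE e be < 1;
  wB_gt0 : forall e be, 0 < @wB e be;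
  wB_sum : forall e, \sum_be @wB e be = 1;
  decomposition : forall K p, poly_space kd k p ->
    pavg K p = \sum_al @wI K al * peval p (@xI K al) +
      \sum_(e | owner e == K) \sum_be @wE e be * peval p (@xE e be)
}.

Arguments nI {M kd k} q K : rename.
Arguments nE {M kd k} q e : rename.
Arguments xI {M kd k} q K al : rename.
Arguments xE {M kd k} q e be : rename.
Arguments wI {M kd k} q K al : rename.
Arguments wE {M kd k} q e be : rename.
Arguments wB {M kd k} q e be : rename.

(* A cell polynomial in [Z^k(K)]^m; a piecewise polynomial is one for each cell. *)
Definition cpoly (m : nat) := {ffun 'I_m -> mpoly.mpoly d R}.
Definition dgfun M (m : nat) := {ffun cell M -> cpoly m}.

Definition in_space kd k m (q : cpoly m) : Prop :=
  forall i, poly_space kd k (q i).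
Definition in_Vh M kd k m (u : dgfun M m) : Prop :=
  forall K, in_space kd k (u K).

Definition ceval m (q : cpoly m) (x : 'rV[R]_d) : 'rV[R]_m :=
  \row_i peval (q i) x.
Definition cavg M (K : cell M) m (q : cpoly m) : 'rV[R]_m :=
  \row_i pavg K (q i).

(* The flux f = [f_1, ..., f_d]. *)
Definition flux (m : nat) := 'I_d -> 'rV[R]_m -> 'rV[R]_m.
Definition nflux m (f : flux m) (nu : 'rV[R]_d) (u : 'rV[R]_m) : 'rV[R]_m :=
  \sum_j nu 0 j *: f j u.

Definition C1_flux m (f : flux m) (B : set 'rV[R]_m) : Prop :=
  exists D : set 'rV[R]_m, [/\ open D, B `<=` D &
    forall j u, D u -> differentiable (f j) u /\
                       {for u, continuous (jacobian (f j))}].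

(* Exterior states at boundary edges: a function of the edge, the node and the
   interior state. *)
Definition bdata M (m : nat) := edge M -> 'rV[R]_d -> 'rV[R]_m -> 'rV[R]_m.

Section scheme.
Context {M : mesh R d} {kd : poly_kind} {k : nat} (Q : quadrature M kd k).

Definition nodes (K : cell M) : set 'rV[R]_d :=
  [set x | (exists al, x = xI Q K al) \/
           (exists e be, owner e = K /\ x = xE Q e be)].

Section states.
Context {m : nat} (bc : bdata M m).
Implicit Types u v w : dgfun M m.

Definition u_int u (e : edge M) (be : 'I_(nE Q e)) : 'rV[R]_m :=
  ceval (u (owner e)) (xE Q e be).
Definition u_ext u (e : edge M) (be : 'I_(nE Q e)) : 'rV[R]_m :=
  match nbr e with
  | Some e' => ceval (u (owner e')) (xE Q e be + shift e)
  | None => bc e (xE Q e be) (u_int u be)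
  end.

Definition on_S (B : set 'rV[R]_m) (K : cell M) (q : cpoly m) : Prop :=
  forall x, nodes K x -> B (ceval q x).
Definition on_Sbar (B : set 'rV[R]_m) (K : cell M) u : Prop :=
  on_S B K (u K) /\
  forall e (be : 'I_(nE Q e)), owner e = K -> B (u_ext u be).

Definition nodal_states u : set 'rV[R]_m :=
  [set w | (exists K x, nodes K x /\ w = ceval (u K) x) \/
           (exists e (be : 'I_(nE Q e)), w = u_ext u be)].

(* [w] is the DG divergence of f(u) with flux function [fl e uint uext] on the
   edge e. This is a relation, since f(u) need not make sense inside the cells
   for every u. *)
Definition dg_divergence (f : flux m)
    (fl : edge M -> 'rV[R]_m -> 'rV[R]_m -> 'rV[R]_m) u w : Prop :=
  in_Vh kd k w /\
  forall v, in_Vh kd k v -> forall K,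
    integral_on (body K) (fun x => dotv (ceval (w K) x) (ceval (v K) x)) =
    - integral_on (body K) (fun x => \sum_i \sum_j
          f j (ceval (u K) x) 0 i * peval (mpoly.mderiv j (v K i)) x)
    + \sum_(e | owner e == K) edge_len e * \sum_be wB Q e be *
        dotv (fl e (u_int u be) (u_ext u be)) (ceval (v K) (xE Q e be)).

(* The numerical flux may depend on the whole of u, as the Lax-Friedrichs flux does
   through its viscosity coefficient. *)
Definition num_flux :=
  dgfun M m -> edge M -> 'rV[R]_m -> 'rV[R]_m -> 'rV[R]_m.

Definition is_F (f : flux m) (fhat : num_flux) u w : Prop :=
  dg_divergence f (fhat u) u (- w).
Definition is_G (f : flux m) u w : Prop :=
  dg_divergence f (fun e ui _ => nflux f (normal e) ui) u (- w).

Definition wave_speeds (f : flux m) (A : set 'rV[R]_m) : set R :=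
  [set r | exists (e : edge M) (a : 'rV[R]_m) lam, [/\ A a,
     eigenvalue (jacobian (nflux f (normal e)) a) lam & r = `|lam|]].

Definition lambda (dt : R) : R :=
  sup [set r | exists e : edge M, r = dt * edge_len e / cell_vol (owner e)].
Definition c_G : R := inf [set r | exists e be, r = wE Q e be / wB Q e be].

(* [relevant u] is the set of states of u over which the wave speeds are taken. *)
Definition weak_F (f : flux m) (fhat : num_flux) (B : set 'rV[R]_m)
    (relevant : dgfun M m -> set 'rV[R]_m) (a0 cF : R) : Prop :=
  forall dt u w, 0 < dt -> in_Vh kd k u -> is_F f fhat u w ->
    ubound (wave_speeds f (relevant u)) a0 -> lambda dt * a0 <= cF ->
    forall K, on_Sbar B K u -> B (cavg K ((u + dt *: w) K)).

(* [L K q r]: on the cell K, the limiter turns the cell polynomial q into r. *)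
Definition limiter := cell M -> cpoly m -> cpoly m -> Prop.

Definition scaling_limiter (B : set 'rV[R]_m) (L : limiter) : Prop :=
  forall K q r, in_space kd k q -> L K q r ->
    [/\ in_space kd k r, cavg K r = cavg K q &
        B (cavg K q) -> on_S B K r].

Definition limited (L : limiter) u v : Prop := forall K, L K (u K) (v K).

End states.
Arguments num_flux : clear implicits.
Arguments limiter : clear implicits.

Definition node_max K (g : 'rV[R]_d -> R) : R := sup [set g x | x in nodes K].
Definition node_min K (g : 'rV[R]_d -> R) : R := inf [set g x | x in nodes K].

(* In a minimum with 1, a quotient with zero denominator is ignored. *)
Definition quot (a b : R) : R := if b == 0 then 1 else a / b.

Definition squeeze (theta : R) p (a : R) : mpoly.mpoly d R :=
  theta *: (p - mpoly.mpolyC d a) + mpoly.mpolyC d a.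

Definition interval_region (lo hi : R) : set 'rV[R]_1 :=
  [set u | lo <= u 0 0 <= hi].

Definition scalar_limiter (lo hi : R) : limiter 1 := fun K q r =>
  let a := pavg K (q 0) in
  let theta :=
    Num.min `|quot (hi - a) (node_max K (peval (q 0)) - a)|
      (Num.min `|quot (lo - a) (node_min K (peval (q 0)) - a)| 1) in
  r = [ffun i => squeeze theta (q i) a].

(* Euler states are u = (rho, m, E), with m in R^d. *)
Definition rho (u : 'rV[R]_(1 + d + 1)) : R := lsubmx (lsubmx u) 0 0.
Definition mom (u : 'rV[R]_(1 + d + 1)) : 'rV[R]_d := rsubmx (lsubmx u).
Definition energy (u : 'rV[R]_(1 + d + 1)) : R := rsubmx u 0 0.
Definition rhoe (u : 'rV[R]_(1 + d + 1)) : R :=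
  energy u - dotv (mom u) (mom u) / (2 * rho u).
Definition pressure (gamma : R) (u : 'rV[R]_(1 + d + 1)) : R :=
  (gamma - 1) * rhoe u.

Definition euler_flux (gamma : R) : flux (1 + d + 1) := fun j u =>
  row_mx
    (row_mx (mom u 0 j)%:M
       ((mom u 0 j / rho u) *: mom u + pressure gamma u *: delta_mx 0 j))
    ((energy u + pressure gamma u) * (mom u 0 j / rho u))%:M.

Definition euler_region (gamma : R) : set 'rV[R]_(1 + d + 1) :=
  [set u | 0 < rho u /\ 0 < pressure gamma u].

Definition rho_index : 'I_(1 + d + 1) := lshift 1 (lshift d ord0).

Definition euler_limiter_eps (eps : R) (K : cell M) (q : cpoly (1 + d + 1)) :
    cpoly (1 + d + 1) :=
  let a := cavg K q in
  let theta1 := Num.min 1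
    (quot (rho a - eps) (rho a - node_min K (fun x => rho (ceval q x)))) in
  let qh : cpoly (1 + d + 1) :=
    [ffun i => if i == rho_index then squeeze theta1 (q i) (a 0 i) else q i] in
  let theta2 := Num.min 1
    (quot (rhoe a - eps) (rhoe a - node_min K (fun x => rhoe (ceval qh x)))) in
  [ffun i => squeeze theta2 (qh i) (a 0 i)].

Definition euler_limiter (gamma : R) : limiter (1 + d + 1) := fun K q r =>
  exists eps : R, [/\ 0 < eps,
    euler_region gamma (cavg K q) ->
      eps <= rho (cavg K q) /\ eps <= rhoe (cavg K q) &
    r = euler_limiter_eps eps K q].

Definition hyperbolic m (f : flux m) (B : set 'rV[R]_m) : Prop :=
  forall u nu, B u -> dotv nu nu = 1 -> diagonalizable (jacobian (nflux f nu) u).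

Definition LF_splitting m (f : flux m) (B : set 'rV[R]_m) : Prop :=
  forall u nu a, B u -> dotv nu nu = 1 -> 0 < a ->
    (forall lam, eigenvalue (jacobian (nflux f nu) u) lam -> `|lam| <= a) ->
    B (u + a^-1 *: nflux f nu u) /\ B (u - a^-1 *: nflux f nu u).

(* [covered bc f B L relevant]: the equation with flux f and region B is one of the
   problems considered, L is its scaling limiter, and a_0 is to be taken over
   the states [relevant u]. *)
Inductive covered : forall m, bdata M m -> flux m -> set 'rV[R]_m -> limiter m ->
    (dgfun M m -> set 'rV[R]_m) -> Prop :=
| covered_scalar (bc : bdata M 1) (f : flux 1) (lo hi : R) of low_dim_mesh M :
    covered bc f (interval_region lo hi) (scalar_limiter lo hi)
      (fun=> interval_region lo hi)
| covered_euler (bc : bdata M (1 + d + 1)) (gamma : R)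
    of low_dim_mesh M & 1 < gamma :
    covered bc (euler_flux gamma) (euler_region gamma) (euler_limiter gamma)
      (nodal_states bc)
| covered_system m (bc : bdata M m) (f : flux m) (B : set 'rV[R]_m)
    (L : limiter m) of
    convex_set (B : set (convex_lmodType 'rV[R]_m)) &
    hyperbolic f B & LF_splitting f B & scaling_limiter B L :
    covered bc f B L (nodal_states bc).

(* One step of the limited method: [un] and [un1] are the limited solutions at the
   two time levels, [u i] the stages and [ut i] the limited stages; [g i] and
   [F i] are the values of the operators at [ut i]. *)
Definition limited_step m (bc : bdata M m) (f : flux m) (fhat : num_flux m)
    (L : limiter m) (dt : R) s (a : 'M[R]_s) (b : 'rV[R]_s) (un un1 : dgfun M m)
    (u ut g F : 'I_s -> dgfun M m) : Prop :=
  [/\ in_Vh kd k un,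
      forall i, u i = un + dt *: \sum_(j < s | (j < i)%N) a i j *: g j,
      forall i, limited L (u i) (ut i),
      forall i, is_G bc f (ut i) (g i) /\ is_F bc f fhat (ut i) (F i) &
      limited L (un + dt *: \sum_i b 0 i *: F i) un1].

End scheme.
End dg.
Arguments num_flux {R d} M m.
Arguments limiter {R d} M m.
Arguments lambda {R d} M dt.
Arguments wave_speeds {R d} M {m} f A.

Section formal.
Context {R : realType} (s : nat).

(* The symbols u^n, G(u^(j)), F(u^(j)). *)
Definition symbol := (unit + ('I_s + 'I_s))%type.
Definition formal := {ffun symbol -> R^o}.
Definition sym (x : symbol) : formal := [ffun y => (y == x)%:R].
Definition symU : formal := sym (inl tt).
Definition symG (j : 'I_s) : formal := sym (inr (inl j)).
Definition symF (j : 'I_s) : formal := sym (inr (inr j)).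

Context (a : 'M[R]_s) (b : 'rV[R]_s) (dt : R).

Definition inner_stage (i : 'I_s) : formal :=
  symU + dt *: \sum_(j < s | (j < i)%N) a i j *: symG j.
Definition final_stage : formal := symU + dt *: \sum_i b 0 i *: symF i.

(* Stage numbers start from 0: the inner stages are 0, ..., s-1, the final one is s. *)
Definition stage (i : 'I_s.+1) : formal :=
  if unlift ord_max i is Some j then inner_stage j else final_stage.

Context (wF wP wM muF muP muM : 'M[R]_(s.+1, s)).

(* [wF], [wP], [wM] are the weights of the steps with F, +G, -G in the convex
   combinations; a step occurs when its weight is positive. *)
Definition convex_combination : Prop :=
  forall i : 'I_s.+1, (0 < i)%N ->
  [/\ forall j, [/\ 0 <= wF i j, 0 <= wP i j & 0 <= wM i j],
      \sum_(j < s | (j < i)%N) (wF i j + wP i j + wM i j) = 1 &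
      stage i = \sum_(j < s | (j < i)%N)
        (wF i j *: (inner_stage j + (dt * muF i j) *: symF j) +
         wP i j *: (inner_stage j + (dt * muP i j) *: symG j) +
         wM i j *: (inner_stage j - (dt * muM i j) *: symG j))].

Definition for_all_steps (P : R -> Prop) (w mu : 'M[R]_(s.+1, s)) : Prop :=
  forall (i : 'I_s.+1) (j : 'I_s), (j < i)%N -> 0 < w i j -> P (mu i j).

Definition positive_steps : Prop :=
  [/\ for_all_steps (fun mu => 0 < mu) wF muF,
      for_all_steps (fun mu => 0 < mu) wP muP &
      for_all_steps (fun mu => 0 < mu) wM muM].

(* x <= min (cF / muF, cG / muP, cG / muM) over the steps that occur *)
Definition cfl (x cF cG : R) : Prop :=
  [/\ for_all_steps (fun mu => x <= cF / mu) wF muF,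
      for_all_steps (fun mu => x <= cG / mu) wP muP &
      for_all_steps (fun mu => x <= cG / mu) wM muM].

End formal.

(* Main.v *)
Require Import Defs.
From HB Require Import structures.
From mathcomp Require Import all_boot all_order all_algebra.
From mathcomp Require Import ring lra.
From mathcomp Require Import all_classical all_reals all_analysis.
From mathcomp.multinomials Require mpoly.
Import (canonicals, coercions) mpoly.

Set Implicit Arguments.
Unset Strict Implicit.
Unset Printing Implicit Defensive.

Import Order.TTheory GRing.Theory Num.Theory.
Import numFieldNormedType.Exports.

Local Open Scope classical_set_scope.
Local Open Scope ring_scope.

(** Cell averages are exact convex combinations of nodal values, so everything
reduces to the averages of the stages; these are not changed by the limiter.
Evaluating the formal identity on cell averages, the average of a stage is a convex
combination of averages of forward-Euler steps from limited stages, which are in B at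
all nodes. F-steps keep the average in B by hypothesis. Testing the definition of G
with constants turns the average of a +-G-step into a convex combination of nodal
values u and edge values u - t f(u).nu, with |t| a_0 <= 1 by the CFL condition. For
systems, each edge value is in B by Lax-Friedrichs splitting; for the Euler equations
this rests on the acoustic eigenvalues v.nu +- c of the flux Jacobian. For scalar laws
the edge values themselves may leave [m, M], but they are nondecreasing in u, and for
constant u they average back to u since the sum of |e| nu_e over the edges of a cell
vanishes; this sum is computed directly for intervals, rectangles and triangles. *)

(** * Convexity and cell averages *)

Section convexity.
Context {R : realType} {V : lmodType R}.
Implicit Types (B : set V) (x y : V) (t w : R).

Definition is_convex B :=
  forall x y t, B x -> B y -> 0 <= t -> t <= 1 -> B (t *: x + (1 - t) *: y).

(* Homogenization of B, so that Jensen's inequality can be proved term by term on nested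
   sums carrying weights and points along. *)
Definition cone B w x : Prop :=
  (w = 0 /\ x = 0) \/ (0 < w /\ exists2 y, B y & x = w *: y).

Lemma cone0 B : cone B 0 0.
Proof. by left. Qed.

(** Membership in [B] is asked only when the weight is positive, so a term of weight 0 may carry an
    arbitrary point. This is what lets steps that do not occur escape the CFL condition. *)
Lemma coneP B w x : 0 <= w -> (0 < w -> B x) -> cone B w (w *: x).
Proof.
rewrite le_eqVlt => /predU1P[<- _|w0 Bx]; first by rewrite scale0r; left.
by right; split => //; exists x => //; exact: Bx.
Qed.

Lemma cone1 B x : cone B 1 x -> B x.
Proof.
move=> [[/eqP]|[_ [y By ->]]]; first by rewrite oner_eq0.
by rewrite scale1r.
Qed.

Lemma coneD B w x w' x' :
  is_convex B -> cone B w x -> cone B w' x' -> cone B (w + w') (x + x').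
Proof.
move=> cvxB [[-> ->]|[w0 [y By ->]]]; first by rewrite !add0r.
move=> [[-> ->]|[w'0 [y' By' ->]]].
  by rewrite !addr0; right; split => //; exists y.
have ww0 : 0 < w + w' by rewrite addr_gt0.
right; split => //; exists (w / (w + w') *: y + (1 - w / (w + w')) *: y').
  apply: cvxB => //; first by rewrite divr_ge0// ltW.
  by rewrite ler_pdivrMr// mul1r lerDl ltW.
rewrite scalerDr !scalerA; congr (_ *: _ + _ *: _); field; lra.
Qed.

Lemma cone_sum B (I : Type) (r : seq I) (P : pred I) (w : I -> R) (x : I -> V) :
  is_convex B -> (forall i, P i -> cone B (w i) (x i)) ->
  cone B (\sum_(i <- r | P i) w i) (\sum_(i <- r | P i) x i).
Proof.
move=> cvxB H; elim/big_ind2 : _ => //; first exact: cone0.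
by move=> *; exact: coneD.
Qed.

End convexity.

(** * Linearity of cell averages and their nodal decomposition *)

Section averages.
Context {R : realType} {d : nat}.
Implicit Types (p q : mpoly.mpoly d R).

Local Notation mpolyC := (@mpoly.mpolyC d R).

Lemma peval_linear t p q (x : 'rV[R]_d) :
  peval (t *: p + q) x = t * peval p x + peval q x.
Proof. by rewrite /peval mpoly.mevalD mpoly.mevalZ. Qed.

Lemma pevalC c (x : 'rV[R]_d) : peval (mpolyC c) x = c.
Proof. exact: mpoly.mevalC. Qed.

Lemma poly_spaceC kd k c : poly_space kd k (mpolyC c).
Proof.
case: kd => /=; first by rewrite mpoly.msizeC; case: eqP.
move=> mm; rewrite mpoly.msuppC; case: eqP => // _.
by rewrite inE => /eqP -> i; rewrite mpoly.mnm0E.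
Qed.

Lemma poly_space_linear kd k t p q :
  poly_space kd k p -> poly_space kd k q -> poly_space kd k (t *: p + q).
Proof.
case: kd => /= hp hq.
  rewrite (leq_trans (mpoly.msizeD_le _ _))// geq_max hq andbT.
  exact: leq_trans (mpoly.msizeZ_le _ _) hp.
move=> mm /mpoly.msuppD_le; rewrite mem_cat => /orP[/mpoly.msuppZ_le|]; auto.
Qed.

Context {M : mesh R d}.

Lemma cell_vol_gt0 (K : cell M) : 0 < cell_vol K.
Proof. by rewrite /cell_vol fine_gt0// body_vol. Qed.

Lemma integral_on_cst (K : cell M) c :
  integral_on (body K) (fun=> c) = c * cell_vol K.
Proof.
by rewrite /integral_on Rintegral_cst//; exact: body_measurable.
Qed.

Lemma pavgC (K : cell M) c : pavg K (mpolyC c) = c.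
Proof.
rewrite /pavg (_ : peval _ = fun=> c); last by apply/funext => x; rewrite pevalC.
by rewrite integral_on_cst mulrC mulfK// gt_eqF// cell_vol_gt0.
Qed.

Context {kd : poly_kind} {k : nat} (Q : quadrature M kd k).

(** Linearity is obtained from the exact nodal decomposition, which replaces the integral over the
    cell by a finite sum of point values. *)
Lemma pavg_linear (K : cell M) t p q : poly_space kd k p -> poly_space kd k q ->
  pavg K (t *: p + q) = t * pavg K p + pavg K q.
Proof.
move=> hp hq; rewrite !(decomposition Q)//; last exact: poly_space_linear.
rewrite mulrDr !mulr_sumr addrACA -!big_split /=; congr (_ + _).
  by apply: eq_bigr => i _; rewrite peval_linear mulrDr mulrCA.
apply: eq_bigr => e _; rewrite mulr_sumr -big_split /=.
by apply: eq_bigr => i _; rewrite peval_linear mulrDr mulrCA.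
Qed.

(** The decomposition applied to the constant polynomial 1. *)
Lemma weight_sum (K : cell M) :
  \sum_(al < nI Q K) wI al +
  \sum_(e | owner e == K) \sum_(be < nE Q e) wE be = 1.
Proof.
have := decomposition Q K (poly_spaceC kd k 1); rewrite pavgC => ->.
congr (_ + _); first by apply: eq_bigr => i _; rewrite pevalC mulr1.
by apply: eq_bigr => e _; apply: eq_bigr => i _; rewrite pevalC mulr1.
Qed.

Context {m : nat}.
Implicit Types (v w : @cpoly R d m).

Lemma in_space_linear t v w :
  in_space kd k v -> in_space kd k w -> in_space kd k (t *: v + w).
Proof. by move=> hv hw i; rewrite !ffunE; exact: poly_space_linear. Qed.

Lemma in_space0 : in_space kd k (0 : @cpoly R d m).
Proof. by move=> i; rewrite ffunE -mpoly.mpolyC0; exact: poly_spaceC. Qed.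

Lemma in_spaceZ t v : in_space kd k v -> in_space kd k (t *: v).
Proof. by move=> hv; rewrite -[_ *: _]addr0; exact: in_space_linear in_space0. Qed.

Lemma in_spaceD v w : in_space kd k v -> in_space kd k w -> in_space kd k (v + w).
Proof. by rewrite -[v in v + _]scale1r; exact: in_space_linear. Qed.

Lemma in_space_sum (I : Type) (r : seq I) (P : pred I) (F : I -> @cpoly R d m) :
  (forall i, P i -> in_space kd k (F i)) ->
  in_space kd k (\sum_(i <- r | P i) F i).
Proof.
move=> H; elim/big_ind : _ => //; [exact: in_space0|exact: in_spaceD].
Qed.

Lemma cavg_linear (K : cell M) t v w : in_space kd k v -> in_space kd k w ->
  cavg K (t *: v + w) = t *: cavg K v + cavg K w.
Proof.
by move=> hv hw; apply/rowP => i; rewrite !mxE !ffunE pavg_linear.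
Qed.

Lemma cavg0 (K : cell M) : cavg K (0 : @cpoly R d m) = 0.
Proof. by apply/rowP => i; rewrite !mxE ffunE -mpoly.mpolyC0 pavgC. Qed.

Lemma cavgZ (K : cell M) t v : in_space kd k v -> cavg K (t *: v) = t *: cavg K v.
Proof.
by move=> hv; rewrite -[t *: v]addr0 cavg_linear ?cavg0 ?addr0//; exact: in_space0.
Qed.

Lemma cavgD (K : cell M) v w : in_space kd k v -> in_space kd k w ->
  cavg K (v + w) = cavg K v + cavg K w.
Proof. by move=> hv hw; rewrite -[v in v + _]scale1r cavg_linear ?scale1r. Qed.

Lemma cavg_sum (K : cell M) (I : Type) (r : seq I) (P : pred I) (F : I -> @cpoly R d m) :
  (forall i, P i -> in_space kd k (F i)) ->
  cavg K (\sum_(i <- r | P i) F i) = \sum_(i <- r | P i) cavg K (F i).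
Proof.
(* Additivity of the average holds only inside the polynomial space, so the induction carries
   membership along with the value. *)
move=> H; pose S v x := in_space kd k v /\ cavg K v = x.
suff [] : S (\sum_(i <- r | P i) F i) (\sum_(i <- r | P i) cavg K (F i)) by [].
elim/big_ind2 : _ => [|v x w y [hv <-] [hw <-]|i Pi].
- by split; [exact: in_space0|exact: cavg0].
- by split; [exact: in_spaceD|rewrite cavgD].
- by split => //; exact: H.
Qed.

Lemma cavg_decomposition (K : cell M) v : in_space kd k v ->
  cavg K v = \sum_(al < nI Q K) wI al *: ceval v (xI al) +
    \sum_(e | owner e == K) \sum_(be < nE Q e) wE be *: ceval v (xE be).
Proof.
move=> hv; apply/rowP => i; rewrite !mxE (decomposition Q)// !summxE.
congr (_ + _); first by apply: eq_bigr => al _; rewrite !mxE.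
apply: eq_bigr => e _; rewrite summxE.
by apply: eq_bigr => be _; rewrite !mxE.
Qed.

Lemma wI_ge0 (K : cell M) (al : 'I_(nI Q K)) : 0 <= wI al.
Proof. by have /andP[/ltW] := wI_01 al. Qed.

Lemma wE_gt0 (e : edge M) (be : 'I_(nE Q e)) : 0 < wE be.
Proof. by have /andP[] := wE_01 be. Qed.

Lemma nodesI (K : cell M) (al : 'I_(nI Q K)) : nodes Q K (xI al).
Proof. by left; exists al. Qed.

Lemma nodesE (e : edge M) (be : 'I_(nE Q e)) : nodes Q (owner e) (xE be).
Proof. by right; exists e, be. Qed.

(** The edge values [y] need not be traces of a polynomial: they will be the values u - t f(u).nu
    produced by a step with the local operator. *)
Lemma nodal_average_convex (B : set 'rV[R]_m) (K : cell M) (z : 'rV[R]_d -> 'rV[R]_m)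
    (y : forall e, 'I_(nE Q e) -> 'rV[R]_m) :
  is_convex B -> (forall al : 'I_(nI Q K), B (z (xI al))) ->
  (forall e (be : 'I_(nE Q e)), owner e = K -> B (y e be)) ->
  B (\sum_(al < nI Q K) wI al *: z (xI al) +
     \sum_(e | owner e == K) \sum_(be < nE Q e) wE be *: y e be).
Proof.
move=> cvxB Bz By; apply: cone1; rewrite -(weight_sum K); apply: coneD => //.
  by apply: cone_sum => // al _; apply: coneP => //; exact: wI_ge0.
apply: cone_sum => // e /eqP eK; apply: cone_sum => // be _.
by apply: coneP => [|_]; [exact/ltW/wE_gt0|exact: By].
Qed.

Lemma on_S_cavg (B : set 'rV[R]_m) (K : cell M) v :
  is_convex B -> in_space kd k v -> on_S Q B K v -> B (cavg K v).
Proof.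
move=> cvxB hv Bv; rewrite cavg_decomposition//.
apply: (nodal_average_convex (z := ceval v) (y := fun e be => ceval v (xE be))) => //.
  by move=> al; apply: Bv; exact: nodesI.
by move=> e be eK; apply: Bv; rewrite -eK; exact: nodesE.
Qed.

End averages.

(** * Forward-Euler steps with the local operator *)

Section mesh_constants.
Context {R : realType} {d : nat} {M : mesh R d}.

Lemma edge_len_ge0 (e : edge M) : 0 <= edge_len e.
Proof. exact/fine_ge0/measure_ge0. Qed.

Lemma lambda_ubound (dt : R) (e : edge M) :
  0 <= dt -> dt * edge_len e / cell_vol (owner e) <= lambda M dt.
Proof.
move=> dt0; apply: ub_le_sup; last by exists e.
(* Finitely many nonnegative ratios are bounded by their sum, so the supremum is a genuine one. *)
exists (\sum_(e : edge M) dt * edge_len e / cell_vol (owner e)) => _ [e' ->].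
rewrite (bigD1 e') //= lerDl; apply: sumr_ge0 => e'' _.
by rewrite divr_ge0 ?mulr_ge0 ?edge_len_ge0//; exact/ltW/cell_vol_gt0.
Qed.

Lemma lambdaZ_le (dt mu : R) : 0 <= dt -> 0 <= mu ->
  lambda M (dt * mu) <= mu * lambda M dt.
Proof.
move=> dt0 mu0; have [[x Ex]|] := pselect
    ([set r | exists e : edge M, r = dt * mu * edge_len e / cell_vol (owner e)] !=set0).
  apply: ge_sup; first by exists x.
  move=> _ [e ->]; rewrite -!mulrA mulrCA ler_wpM2l// !mulrA.
  exact: lambda_ubound.
(* Without edges both suprema are over the empty set, where [sup] is 0 by convention. *)
move=> H; rewrite /lambda (_ : [set r | _] = set0); last first.
  by apply: contrapT => /eqP/set0P.
rewrite sup0 mulr_ge0// (_ : [set r | _] = set0) ?sup0//.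
apply: contrapT => /eqP/set0P[_ [e _]]; apply: H.
by exists (dt * mu * edge_len e / cell_vol (owner e)); exists e.
Qed.

Context {kd : poly_kind} {k : nat} (Q : quadrature M kd k).

Lemma c_G_lbound (e : edge M) (be : 'I_(nE Q e)) : c_G Q <= wE be / wB be.
Proof.
apply: ge_inf; last by exists e, be.
exists 0 => _ [e' [be' ->]].
by rewrite divr_ge0 ?ltW ?wE_gt0 ?wB_gt0.
Qed.

(* The factor t for which an edge node contributes the value u - t f(u).nu. *)
Definition edge_step (t : R) (e : edge M) (be : 'I_(nE Q e)) : R :=
  t * edge_len e / cell_vol (owner e) * (wB be / wE be).

(** The geometric factor is at most [lambda] for the step |t|, and the ratio of the weights is the
    inverse of one bounded below by [c_G Q]. *)
Lemma edge_step_cfl (t a0 : R) (e : edge M) (be : 'I_(nE Q e)) :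
  0 <= a0 -> lambda M `|t| * a0 <= c_G Q -> `|edge_step t be| * a0 <= 1.
Proof.
move=> a0_ge0 cfl; have w0 := wE_gt0 be; have b0 := wB_gt0 be.
have v0 := cell_vol_gt0 (owner e); have l0 := edge_len_ge0 e.
rewrite !normrM !normfV !(gtr0_norm w0) (gtr0_norm b0) (gtr0_norm v0) (ger0_norm l0).
rewrite mulrAC -ler_pdivlMr ?divr_gt0// invf_div mul1r.
apply: le_trans (c_G_lbound be); apply: le_trans cfl.
by rewrite ler_wpM2r// lambda_ubound.
Qed.

End mesh_constants.

Section local_divergence.
Context {R : realType} {d : nat} {M : mesh R d} {kd : poly_kind} {k : nat}.
Context (Q : quadrature M kd k) {m : nat} (bc : bdata M m) (f : @flux R d m).
Implicit Types (u w : dgfun M m).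

Lemma dotv_delta (x : 'rV[R]_m) (i : 'I_m) : dotv x (delta_mx 0 i) = x 0 i.
Proof.
rewrite /dotv (bigD1 i)//= mxE !eqxx mulr1 big1 ?addr0// => j ji.
by rewrite mxE eqxx (negPf ji) mulr0.
Qed.

Lemma is_G_in_Vh u w : is_G Q bc f u w -> in_Vh kd k w.
Proof.
move=> [h _] K; rewrite -[w K]opprK -scaleN1r; apply: in_spaceZ.
by have := h K; rewrite ffunE.
Qed.

Lemma is_F_in_Vh fhat u w : is_F Q bc f fhat u w -> in_Vh kd k w.
Proof.
move=> [h _] K; rewrite -[w K]opprK -scaleN1r; apply: in_spaceZ.
by have := h K; rewrite ffunE.
Qed.

(* Test functions that are constant and equal to a basis vector make the volume
   term vanish. *)
Lemma is_G_cavg u w (K : cell M) : is_G Q bc f u w ->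
  cavg K (w K) = - (cell_vol K)^-1 *: \sum_(e | owner e == K) edge_len e *:
    \sum_(be < nE Q e) wB be *: nflux f (normal e) (u_int u be).
Proof.
move=> Gw'; have [_ Gw] := Gw'; apply/rowP => i.
pose v : dgfun M m := [ffun=> [ffun j => mpoly.mpolyC d (i == j)%:R]].
have vx K' x : ceval (v K') x = delta_mx 0 i.
  by apply/rowP => j; rewrite !mxE !ffunE pevalC /= eq_sym.
have vV : in_Vh kd k v by move=> K' j; rewrite !ffunE; exact: poly_spaceC.
have := Gw v vV K.
rewrite (_ : (fun x => dotv _ _) = peval ((- w) K i)); last first.
  by apply/funext => x; rewrite vx dotv_delta mxE.
rewrite (_ : (fun x => \sum_i _) = fun=> 0); last first.
  apply/funext => x; rewrite big1// => i' _; rewrite big1// => j _.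
  by rewrite !ffunE mpoly.mderivC -mpoly.mpolyC0 pevalC mulr0.
rewrite integral_on_cst mul0r oppr0 add0r => /(congr1 ( *%R (cell_vol K)^-1)).
rewrite (_ : _ * integral_on _ _ = cavg K ((- w) K) 0 i); last by rewrite mxE.
rewrite ffunE -scaleN1r (cavgZ Q) ?scaleN1r; last exact: (is_G_in_Vh Gw').
rewrite mxE => /(canRL opprK) ->; rewrite scaleNr !mxE summxE; congr (- (_ * _)).
apply: eq_bigr => e _; rewrite mxE summxE; congr (_ * _).
by apply: eq_bigr => be _; rewrite vx dotv_delta mxE.
Qed.

(** The edge quadrature of the flux uses the same nodes as the decomposition of the average, so each
    flux value is absorbed into the term of its node; [edge_step] contains the quotient of the two
    weights. *)
Lemma cavg_G_step u w (K : cell M) (t : R) : in_Vh kd k u -> is_G Q bc f u w ->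
  cavg K (u K + t *: w K) =
    \sum_(al < nI Q K) wI al *: ceval (u K) (xI al) +
    \sum_(e | owner e == K) \sum_(be < nE Q e)
      wE be *: (u_int u be - edge_step t be *: nflux f (normal e) (u_int u be)).
Proof.
move=> uV Gw; have wV := is_G_in_Vh Gw.
rewrite addrC (cavg_linear Q)// (is_G_cavg K Gw) (cavg_decomposition Q K (uV K)).
rewrite addrC -addrA; congr (_ + _); rewrite scalerA mulrN scaleNr scaler_sumr.
rewrite -sumrN -big_split /=; apply: eq_bigr => e /eqP eK.
rewrite scalerA scaler_sumr -sumrN -big_split /=; apply: eq_bigr => be _.
rewrite scalerBr /u_int eK !scalerA; congr (_ - _ *: _).
have we0 := gt_eqF (wE_gt0 be); have K0 := gt_eqF (cell_vol_gt0 (owner e)).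
by rewrite /edge_step eK in K0 *; field; rewrite we0 K0.
Qed.

(** The counterpart of [weak_F] for the local operator. The real [t] carries the sign, so that steps
    with +G and -G are treated together. *)
Definition weak_G (B : set 'rV[R]_m) (relevant : dgfun M m -> set 'rV[R]_m) :=
  forall (t a0 : R) u w, in_Vh kd k u -> is_G Q bc f u w -> 0 < a0 ->
    ubound (wave_speeds M f (relevant u)) a0 -> lambda M `|t| * a0 <= c_G Q ->
    (forall K, on_S Q B K (u K)) -> forall K, B (cavg K (u K + t *: w K)).

(** The splitting property is used with a = 1/|t|, which is at least [a0]; the sign of [t] selects
    one of its two conclusions. *)
Lemma LF_splitting_step (B : set 'rV[R]_m) x (nu : 'rV[R]_d) (t a0 : R) :
  LF_splitting f B -> B x -> dotv nu nu = 1 -> 0 < a0 ->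
  (forall lam, eigenvalue (jacobian (nflux f nu) x) lam -> `|lam| <= a0) ->
  `|t| * a0 <= 1 -> B (x - t *: nflux f nu x).
Proof.
move=> LF Bx nu1 a00 eig ta0; have [->|t0] := eqVneq t 0.
  by rewrite scale0r subr0.
have nt0 : 0 < `|t| by rewrite normr_gt0.
have [||Bp Bm] := LF x nu `|t|^-1 Bx nu1; first by rewrite invr_gt0.
  move=> lam /eig /le_trans; apply.
  by rewrite -[_^-1]mul1r ler_pdivlMr// mulrC.
rewrite invrK in Bp Bm.
have [t1|t1] := ger0P t; first by rewrite ger0_norm in Bm.
by rewrite ltr0_norm// scaleNr in Bp.
Qed.

Lemma LF_splitting_weak_G (B : set 'rV[R]_m) :
  is_convex B -> LF_splitting f B -> weak_G B (nodal_states Q bc).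
Proof.
move=> cvxB LF t a0 u w uV Gw a00 a0ub cfl Bu K; rewrite (cavg_G_step K t uV Gw).
apply: (nodal_average_convex (z := ceval (u K))
  (y := fun e be => u_int u be - edge_step t be *: nflux f (normal e) (u_int u be))).
- exact: cvxB.
- by move=> al; apply: Bu; exact: nodesI.
- move=> e be eK; apply: (LF_splitting_step (a0 := a0)) => //.
  + by apply: Bu; exact: nodesE.
  + exact: normal_unit.
  + move=> lam elam; apply: a0ub; exists e, (u_int u be), lam; split => //.
    by left; exists (owner e), (xE be); split => //; exact: nodesE.
  + by apply: edge_step_cfl => //; exact: ltW.
Qed.

End local_divergence.

(** * Euler states and fluxes *)

Section dot_product.
Context {R : realType} {n : nat}.
Implicit Types (t : R) (x y z : 'rV[R]_n).

Lemma dotvC x y : dotv x y = dotv y x.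
Proof. by apply: eq_bigr => i _; rewrite mulrC. Qed.

Lemma dotvDl x y z : dotv (x + y) z = dotv x z + dotv y z.
Proof. by rewrite -big_split; apply: eq_bigr => i _; rewrite mxE mulrDl. Qed.

Lemma dotvZl t x y : dotv (t *: x) y = t * dotv x y.
Proof. by rewrite mulr_sumr; apply: eq_bigr => i _; rewrite mxE mulrA. Qed.

Lemma dotvDr x y z : dotv x (y + z) = dotv x y + dotv x z.
Proof. by rewrite dotvC dotvDl !(dotvC _ x). Qed.

Lemma dotvZr t x y : dotv x (t *: y) = t * dotv x y.
Proof. by rewrite dotvC dotvZl dotvC. Qed.

End dot_product.

Section euler_states.
Context {R : realType} {d : nat}.
Implicit Types (u v : 'rV[R]_(1 + d + 1)) (gamma t c : R).

Lemma rhoE u : rho u = u 0 rho_index.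
Proof. by rewrite /rho !mxE. Qed.

Lemma momE u j : mom u 0 j = u 0 (lshift 1 (rshift 1 j)).
Proof. by rewrite /mom !mxE. Qed.

Lemma energyE u : energy u = u 0 (rshift (1 + d) ord0).
Proof. by rewrite /energy !mxE. Qed.

Lemma euler_index (P : 'I_(1 + d + 1) -> Prop) :
  P rho_index -> (forall j, P (lshift 1 (rshift 1 j))) ->
  P (rshift (1 + d) ord0) -> forall i, P i.
Proof.
move=> Pr Pm PE i; rewrite -(fintype.splitK i); case: (fintype.split i) => [i'|i'] /=.
  by rewrite -(fintype.splitK i'); case: (fintype.split i') => [l|j] //=; rewrite (ord1 l).
by rewrite (ord1 i').
Qed.

Lemma rho_linear t u v : rho (t *: u + v) = t * rho u + rho v.
Proof. by rewrite !rhoE !mxE. Qed.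

Lemma mom_linear t u v : mom (t *: u + v) = t *: mom u + mom v.
Proof. by apply/rowP => j; rewrite !mxE. Qed.

Lemma energy_linear t u v : energy (t *: u + v) = t * energy u + energy v.
Proof. by rewrite !energyE !mxE. Qed.

Lemma rhoZ t u : rho (t *: u) = t * rho u.
Proof. by rewrite !rhoE !mxE. Qed.

Lemma momZ t u : mom (t *: u) = t *: mom u.
Proof. by apply/rowP => j; rewrite !mxE. Qed.

Lemma energyZ t u : energy (t *: u) = t * energy u.
Proof. by rewrite !energyE !mxE. Qed.

(** With a, b the densities of u, v, the defect of concavity is t (1 - t) |b m_u - a m_v|^2 / (2 a b
    (t a + (1 - t) b)), which is nonnegative. *)
Lemma rhoe_concave t u v : 0 < rho u -> 0 < rho v -> 0 <= t -> t <= 1 ->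
  t * rhoe u + (1 - t) * rhoe v <= rhoe (t *: u + (1 - t) *: v).
Proof.
move=> u0 v0 t0 t1; have t1' : 0 <= 1 - t by rewrite subr_ge0.
rewrite /rhoe energy_linear mom_linear rho_linear energyZ momZ rhoZ.
set a := rho u in u0 *; set b := rho v in v0 *.
have ab0 : 0 < t * a + (1 - t) * b by nra.
rewrite dotvDl !dotvDr !dotvZl !dotvZr (dotvC (mom v) (mom u)).
set X := dotv (mom u) (mom u); set Y := dotv (mom u) (mom v).
set Z := dotv (mom v) (mom v).
have : 0 <= b ^+ 2 * X - 2 * a * b * Y + a ^+ 2 * Z.
  rewrite (_ : _ - _ + _ = dotv (b *: mom u - a *: mom v) (b *: mom u - a *: mom v)).
    by apply: sumr_ge0 => i _; rewrite -expr2 sqr_ge0.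
  rewrite -(scaleNr a (mom v)) dotvDl !dotvDr !dotvZl !dotvZr.
  rewrite (dotvC (mom v) (mom u)) -/X -/Y -/Z.
  ring.
move=> H; rewrite -subr_ge0.
rewrite (_ : _ - _ = t * (1 - t) * (b ^+ 2 * X - 2 * a * b * Y + a ^+ 2 * Z) /
   (2 * a * b * (t * a + (1 - t) * b))).
  by rewrite divr_ge0 ?mulr_ge0// ltW// !mulr_gt0.
by field; rewrite !gt_eqF.
Qed.

(** An arbitrary level is allowed: the smaller of two internal energies gives convexity of the Euler
    region, and the nodal minimum serves the limiter. *)
Lemma rhoe_superlevel_convex c : is_convex [set u : 'rV[R]_(1 + d + 1) | 0 < rho u /\ c <= rhoe u].
Proof.
move=> u v t [ru cu] [rv cv] t0 t1; split.
  by rewrite rho_linear rhoZ; nra.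
by apply: le_trans (rhoe_concave ru rv t0 t1); nra.
Qed.

Lemma rho_superlevel_convex c : is_convex [set u : 'rV[R]_(1 + d + 1) | c <= rho u].
Proof.
by move=> u v t /= ru rv t0 t1; rewrite rho_linear rhoZ; nra.
Qed.

Lemma euler_regionP gamma u : 1 < gamma ->
  euler_region gamma u <-> 0 < rho u /\ 0 < rhoe u.
Proof.
by move=> g1; rewrite /euler_region /= /pressure pmulr_rgt0// subr_gt0.
Qed.

Lemma euler_region_convex gamma : 1 < gamma ->
  is_convex (@euler_region R d gamma).
Proof.
move=> g1 u v t /(euler_regionP _ g1)[ru eu] /(euler_regionP _ g1)[rv ev] t0 t1.
apply/(euler_regionP _ g1).
have [] := @rhoe_superlevel_convex (Num.min (rhoe u) (rhoe v)) u v t.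
- by split=> //; rewrite ge_min lexx.
- by split=> //; rewrite ge_min lexx orbT.
- by [].
- by [].
- by move=> r0 le; split => //; apply: lt_le_trans le; rewrite lt_min eu.
Qed.

Section flux.
Context (gamma : R) (nu : 'rV[R]_d).
Local Notation F := (nflux (euler_flux gamma) nu).

Lemma rho_nflux u : rho (F u) = dotv (mom u) nu.
Proof.
rewrite rhoE /nflux summxE; apply: eq_bigr => j _.
by rewrite mxE -rhoE /rho /euler_flux !row_mxKl !mxE eqxx mulr1n mulrC.
Qed.

Lemma mom_nflux u :
  mom (F u) = (dotv (mom u) nu / rho u) *: mom u + pressure gamma u *: nu.
Proof.
apply/rowP => j; rewrite momE /nflux summxE.
transitivity (\sum_i nu 0 i * (mom u 0 i / rho u * mom u 0 j +
   pressure gamma u * (i == j)%:R)).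
  apply: eq_bigr => i _; rewrite mxE -momE /mom /euler_flux !row_mxKl !row_mxKr.
  by rewrite !mxE eqxx /= eq_sym.
under eq_bigr do rewrite mulrDr; rewrite big_split /=; rewrite !mxE; congr (_ + _).
  by rewrite !mulr_suml; apply: eq_bigr => i _; ring.
rewrite (bigD1 j)//= eqxx big1 ?addr0; first by rewrite mulr1 mulrC.
by move=> i /negPf ->; rewrite !mulr0.
Qed.

Lemma energy_nflux u :
  energy (F u) = (energy u + pressure gamma u) * (dotv (mom u) nu / rho u).
Proof.
rewrite energyE /nflux summxE mulrA mulr_sumr mulr_suml; apply: eq_bigr => j _.
rewrite mxE -energyE [in LHS]/energy /euler_flux !row_mxKr !mxE eqxx mulr1n.
ring.
Qed.

End flux.

End euler_states.

(** * Wave speeds of the Euler equations *)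

Section derivatives.
Context {R : realType}.

(** Off 0 the difference quotient is [G] itself, so the derivative follows from continuity of [G] at
    0 alone. *)
Lemma derive_quotient {n : nat} (phi : 'rV[R]_n -> R) (u r : 'rV[R]_n) (G : R -> R) :
  (\forall h \near (0 : R)^', phi (h *: r + u) = phi u + h * G h) ->
  {for 0, continuous G} -> 'D_r phi u = G 0.
Proof.
move=> E cG; apply/cvg_lim => //.
have cG' : G h @[h --> (0 : R)^'] --> G 0.
  by apply: cvg_trans cG; apply: cvg_app; exact: nbhs_dnbhs.
apply: cvg_trans cG'; apply: near_eq_cvg; near=> h.
have h0 : h != 0 by near: h; exact: nbhs_dnbhs_neq.
have /= -> : phi (h *: r + u) = phi u + h * G h by near: h.
by rewrite addrC addKr scalerA mulVf// scale1r.
Unshelve. all: by end_near. Qed.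

(* Along an acoustic direction every component of the Euler flux is rational in the
   parameter h, with powers of rho0 + h as denominators. *)
Lemma derive_rational_path {n : nat} (phi : 'rV[R]_n -> R) (u r : 'rV[R]_n)
    (rho0 A B C D : R) : 0 < rho0 ->
  (forall h, rho0 + h != 0 -> phi (h *: r + u) =
    phi u + h * (A + B / (rho0 + h) + C * (h / (rho0 + h)) +
                 D * (h / (rho0 + h)) ^+ 2)) ->
  'D_r phi u = A + B / rho0.
Proof.
move=> r0 E.
have ci : {for 0, continuous (fun h => (rho0 + h)^-1)}.
  apply: cvgV; first by rewrite addr0 gt_eqF.
  by apply: cvgD; [exact: cvg_cst|exact: cvg_id].
rewrite (@derive_quotient _ _ _ _ (fun h => A + B / (rho0 + h) +
  C * (h / (rho0 + h)) + D * (h / (rho0 + h)) ^+ 2)).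
- by rewrite addr0 mul0r expr0n /= !mulr0 !addr0.
- near=> h; apply: E; rewrite gt_eqF// -ltrBlDl sub0r; near: h.
  by apply: nbhs_dnbhs; apply: lt_nbhsr; rewrite oppr_lt0.
- have ch : h / (rho0 + h) @[h --> (0:R)] --> (0:R) / (rho0 + 0).
    by apply: cvgM => //; exact: cvg_id.
  apply: cvgD; first apply: cvgD; first apply: cvgD.
  + exact: cvg_cst.
  + by apply: cvgM => //; exact: cvg_cst.
  + by apply: cvgM => //; exact: cvg_cst.
  + by apply: cvgM; [exact: cvg_cst|rewrite expr2; exact: cvgM].
Unshelve. all: by end_near. Qed.

(** Directions are row vectors multiplied by the Jacobian on the right, which is also the convention
    of [eigenvalue]; the classical right eigenvector is therefore the one to use. *)
Lemma jacobian_eigenvalue {n : nat} (f : 'rV[R]_n -> 'rV[R]_n) (u r : 'rV[R]_n) lam :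
  differentiable f u -> r != 0 ->
  (forall i, 'D_r (fun x => f x 0 i) u = lam * r 0 i) ->
  eigenvalue (jacobian f u) lam.
Proof.
move=> df r0 H; apply/eigenvalueP; exists r => //.
rewrite -deriveEjacobian// derive_mx; last exact: diff_derivable.
by apply/rowP => i; rewrite !mxE H.
Qed.

Context {d m : nat}.

Lemma differentiable_nflux (f : @flux R d m) (nu : 'rV[R]_d) u :
  (forall j, differentiable (f j) u) -> differentiable (nflux f nu) u.
Proof.
move=> df; rewrite (_ : nflux f nu = \sum_j (nu 0 j \*: f j)); last first.
  by apply/funext => x; rewrite fct_sumE.
by apply: differentiable_sum => j; exact: differentiableZ.
Qed.

Lemma C1_flux_differentiable (f : @flux R d m) (nu : 'rV[R]_d) B u :
  C1_flux f B -> B u -> differentiable (nflux f nu) u.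
Proof.
move=> [D [_ BD fD]] Bu; apply: differentiable_nflux => j.
by have [] := fD j u (BD _ Bu).
Qed.

End derivatives.

Section euler_speeds.
Context {R : realType} {d : nat} (gamma : R) (nu : 'rV[R]_d).
Hypotheses (gamma_gt1 : 1 < gamma) (nu_unit : dotv nu nu = 1).
Implicit Types u : 'rV[R]_(1 + d + 1).

(* The right eigenvector (1, v + c nu, H + c v.nu) with H = (E + p) / rho. *)
Definition acoustic_direction u (c : R) : 'rV[R]_(1 + d + 1) :=
  row_mx (row_mx 1%:M ((rho u)^-1 *: mom u + c *: nu))
    ((energy u + pressure gamma u) / rho u +
       c * (dotv (mom u) nu / rho u))%:M.

(** The flux is expanded explicitly along the line through [u] in the acoustic direction. Only the
    square of [c] is prescribed, so both acoustic speeds are covered. *)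
Lemma euler_eigenvalue u (c : R) : euler_region gamma u ->
  differentiable (nflux (euler_flux gamma) nu) u ->
  c ^+ 2 = gamma * pressure gamma u / rho u ->
  eigenvalue (jacobian (nflux (euler_flux gamma) nu) u)
    (dotv (mom u) nu / rho u + c).
Proof.
move=> [r0 p0] df c2; set r := acoustic_direction u c.
have rr : rho r = 1 by rewrite /rho !row_mxKl mxE eqxx.
have mr : mom r = (rho u)^-1 *: mom u + c *: nu by rewrite /mom row_mxKl row_mxKr.
have er : energy r = (energy u + pressure gamma u) / rho u +
    c * (dotv (mom u) nu / rho u) by rewrite /energy row_mxKr mxE eqxx.
apply: (jacobian_eigenvalue (r := r)) => //.
  by apply/eqP => r_eq0; move/eqP: rr; rewrite r_eq0 rhoE mxE eq_sym oner_eq0.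
set w := dotv (mom u) nu / rho u.
have rx h : rho (h *: r + u) = rho u + h by rewrite rho_linear rr mulr1 addrC.
have mx_ h : mom (h *: r + u) = h *: ((rho u)^-1 *: mom u + c *: nu) + mom u.
  by rewrite mom_linear mr.
have mw : dotv (mom u) nu = w * rho u by rewrite /w divfK// gt_eqF.
have wx h : rho u + h != 0 ->
    dotv (mom (h *: r + u)) nu / rho (h *: r + u) = w + c * (h / (rho u + h)).
  move=> h0; rewrite rx mx_ dotvDl dotvZl dotvDl !dotvZl nu_unit mw.
  by field; rewrite h0 gt_eqF.
have eE : energy u = pressure gamma u / (gamma - 1) +
    dotv (mom u) (mom u) / (2 * rho u).
  by rewrite /pressure /rhoe; field; rewrite !gt_eqF ?subr_gt0.
(* To first order the pressure changes by c^2 times the change h of density, the isentropic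
   relation; the rest is of second order in h. *)
have px h : rho u + h != 0 -> pressure gamma (h *: r + u) =
    pressure gamma u + h * c ^+ 2 - (gamma - 1) * c ^+ 2 / 2 * h * (h / (rho u + h)).
  move=> h0; rewrite [X in h * X]c2 {1}/pressure /rhoe rx mx_ energy_linear er.
  rewrite !(dotvDl, dotvDr) !(dotvZl, dotvZr) !(dotvDl, dotvDr) !(dotvZl, dotvZr).
  rewrite nu_unit (dotvC nu) mw mulfK ?gt_eqF// eE.
  by field; rewrite h0 !gt_eqF ?subr_gt0.
have derive_path (phi : 'rV[R]_(1 + d + 1) -> R) A B C D l :
    (forall h, rho u + h != 0 -> phi (h *: r + u) =
      phi u + h * (A + B / (rho u + h) + C * (h / (rho u + h)) +
                   D * (h / (rho u + h)) ^+ 2)) ->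
    A + B / rho u = l -> 'D_r phi u = l.
  by move=> E <-; exact: derive_rational_path E.
(* The coefficient of the second-order term in [px]. The constants passed to [derive_path] below
   come from multiplying out the expansions [wx] and [px] with the linear components and collecting
   the factors of h. *)
pose kappa := (gamma - 1) * c ^+ 2 / 2.
apply: euler_index => [|j|].
- rewrite -rhoE rr mulr1 (_ : (fun x => _) = fun x => dotv (mom x) nu); last first.
    by apply/funext => x; rewrite -rhoE rho_nflux.
  apply: (derive_path _ (w + c) 0 0 0) => [h h0|]; last by rewrite mul0r addr0.
  rewrite mx_ dotvDl dotvZl dotvDl !dotvZl nu_unit mw.
  by field; rewrite h0 gt_eqF.
- rewrite -momE mr [in RHS]mxE.
  rewrite (_ : (fun x => _) = fun x =>
    dotv (mom x) nu / rho x * mom x 0 j + pressure gamma x * nu 0 j); last first.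
    by apply/funext => x; rewrite -momE mom_nflux !mxE.
  pose a := (rho u)^-1 * mom u 0 j + c * nu 0 j.
  apply: (derive_path _ (w * a + c ^+ 2 * nu 0 j) (c * mom u 0 j)
    (c * a - kappa * nu 0 j) 0) => [h h0|]; last first.
    by rewrite /a !mxE -momE; field; rewrite gt_eqF.
  rewrite wx// px// mx_ -/w !mxE -momE -/a /kappa.
  by field; rewrite h0.
- rewrite -energyE er.
  rewrite (_ : (fun x => _) = fun x =>
    (energy x + pressure gamma x) * (dotv (mom x) nu / rho x)); last first.
    by apply/funext => x; rewrite -energyE energy_nflux.
  pose H := (energy u + pressure gamma u) / rho u.
  pose T := H + c * w + c ^+ 2.
  apply: (derive_path _ (T * w) (c * (energy u + pressure gamma u))
    (T * c - kappa * w) (- kappa * c)) => [h h0|]; last first.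
    by rewrite /T /H -/w; field; rewrite gt_eqF.
  rewrite wx// px// energy_linear er -/w -/H /T /kappa.
  by field; rewrite h0.
Qed.

(** The step multiplies the density by s = 1 + t w. The bounds |w + c| <= a and |w - c| <= a give s
    >= c / a > 0, which controls the density and, through s^2 >= t^2 c^2, the internal energy. *)
Lemma euler_LF_splitting_at u (a : R) : euler_region gamma u -> 0 < a ->
  differentiable (nflux (euler_flux gamma) nu) u ->
  (forall lam, eigenvalue (jacobian (nflux (euler_flux gamma) nu) u) lam ->
     `|lam| <= a) ->
  forall t : R, `|t| = a^-1 -> euler_region gamma (u + t *: nflux (euler_flux gamma) nu u).
Proof.
move=> Bu a0 df eig t ta; have [r0 p0] := Bu.
have [_ e0] := (euler_regionP u gamma_gt1).1 Bu.
set w := dotv (mom u) nu / rho u.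
have mw : dotv (mom u) nu = w * rho u by rewrite /w divfK// gt_eqF.
pose c : R := Num.sqrt (gamma * pressure gamma u / rho u).
have g0 : 0 < gamma by exact: lt_trans ltr01 gamma_gt1.
have gp0 : 0 < gamma * pressure gamma u / rho u.
  by apply: divr_gt0 => //; exact: mulr_gt0.
have c0 : 0 < c by rewrite sqrtr_gt0.
have c2 : c ^+ 2 = gamma * pressure gamma u / rho u.
  by rewrite sqr_sqrtr// ltW.
have lm : `|w - c| <= a by apply: eig; apply: euler_eigenvalue; rewrite // sqrrN.
have lp : `|w + c| <= a by apply: eig; exact: euler_eigenvalue.
have t2 : t ^+ 2 * a ^+ 2 = 1.
  by rewrite -(real_normK (num_real t)) ta -exprMn mulVf ?expr1n// gt_eqF.
(* The two eigenvalue bounds together say |w| <= a - c, and |t| = 1 / a. *)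
have s_ge : c / a <= 1 + t * w.
  have tw : `|t * w| <= a^-1 * (a - c).
    rewrite normrM ta ler_pM2l ?invr_gt0//.
    move: lm lp; rewrite !ler_norml => /andP[? ?] /andP[? ?]; apply/andP; split; lra.
  have : a^-1 * (a - c) = 1 - c / a by field; rewrite gt_eqF.
  by move: tw => /[swap] ->; rewrite ler_norml => /andP[? ?]; lra.
have s0 : 0 < 1 + t * w by apply: lt_le_trans s_ge; rewrite divr_gt0.
apply/(euler_regionP _ gamma_gt1); rewrite addrC.
set s := 1 + t * w in s_ge s0 *.
have re : rho (t *: nflux (euler_flux gamma) nu u + u) = s * rho u.
  by rewrite rho_linear rho_nflux mw /s; ring.
split; first by rewrite re mulr_gt0.
rewrite /rhoe re energy_linear energy_nflux mom_linear mom_nflux -/w.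
rewrite !(dotvDl, dotvDr) !(dotvZl, dotvZr) !(dotvDl, dotvDr) !(dotvZl, dotvZr).
rewrite nu_unit (dotvC nu) mw.
have eE : energy u = rhoe u + dotv (mom u) (mom u) / (2 * rho u).
  by rewrite /rhoe subrK.
set p := pressure gamma u in p0 c2 *; rewrite eE.
set X := dotv _ _.
have pE : p = (gamma - 1) * rhoe u by [].
(* In this closed form the kinetic energy has cancelled. Positivity reduces, after s^2 >= t^2 c^2
   and c^2 = gamma p / rho, to p < 2 gamma [rhoe u], which holds as p = (gamma - 1) [rhoe u]. *)
rewrite (_ : _ - _ = (s ^+ 2 * rhoe u * rho u * 2 - t ^+ 2 * p ^+ 2) / (2 * s * rho u)).
  rewrite divr_gt0 ?mulr_gt0// subr_gt0.
  have s2 : t ^+ 2 * c ^+ 2 <= s ^+ 2.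
    have -> : t ^+ 2 * c ^+ 2 = (c / a) ^+ 2.
      by rewrite expr_div_n -[c ^+ 2 / _]mulr1 -t2; field; rewrite gt_eqF.
    have ca0 : 0 <= c / a by apply: divr_ge0; exact: ltW.
    by rewrite ler_sqr ?nnegrE//; exact: ltW.
  have t20 : 0 < t ^+ 2 by rewrite exprn_even_gt0//= -normr_gt0 ta invr_gt0.
  apply: lt_le_trans (_ : t ^+ 2 * c ^+ 2 * (rhoe u * rho u * 2) <= _); last first.
    rewrite (_ : s ^+ 2 * _ * _ * _ = s ^+ 2 * (rhoe u * rho u * 2)) ?ler_wpM2r//; last by ring.
    by apply: mulr_ge0 => //; apply: mulr_ge0; exact: ltW.
  rewrite c2 (_ : _ * _ * _ = t ^+ 2 * (p * (gamma * rhoe u * 2))); last first.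
    by field; rewrite gt_eqF.
  rewrite ltr_pM2l// expr2 ltr_pM2l// pE.
  nra.
rewrite /s; field; rewrite -/s !gt_eqF//.
Qed.

End euler_speeds.

Lemma euler_LF_splitting {R : realType} {d : nat} (gamma : R) : 1 < gamma ->
  C1_flux (@euler_flux R d gamma) (euler_region gamma) ->
  LF_splitting (@euler_flux R d gamma) (euler_region gamma).
Proof.
move=> g1 fC1 u nu a Bu nu1 a0 eig; rewrite -scaleNr.
have df := C1_flux_differentiable nu fC1 Bu.
by split; apply: (euler_LF_splitting_at g1 nu1 Bu a0) => //;
  rewrite ?normrN ger0_norm// invr_ge0 ltW.
Qed.

(** * Scaling limiters *)

Section limiters.
Context {R : realType} {d : nat} {M : mesh R d} {kd : poly_kind} {k : nat}.
Context (Q : quadrature M kd k).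
Implicit Types (K : cell M) (g : 'rV[R]_d -> R) (theta a : R).

(** There are finitely many nodes, so [node_max] and [node_min] are true bounds and not default
    values of [sup] and [inf]. *)
Lemma nodes_bounded K g : exists C, forall x, nodes Q K x -> `|g x| <= C.
Proof.
exists (\sum_(al < nI Q K) `|g (xI al)| + \sum_e \sum_(be < nE Q e) `|g (xE be)|).
move=> x [[al ->]|[e [be [_ ->]]]].
  rewrite (bigD1 al)//= -addrA lerDl addr_ge0//; apply: sumr_ge0 => // *.
  exact: sumr_ge0.
rewrite addrC (bigD1 e)//= (bigD1 be)//= -!addrA lerDl !addr_ge0// sumr_ge0//.
by move=> *; exact: sumr_ge0.
Qed.

Lemma node_min_le K g x : nodes Q K x -> node_min Q K g <= g x.
Proof.
move=> Kx; apply: ge_inf; last by exists x.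
have [C gC] := nodes_bounded K g.
by exists (- C) => _ [y Ky <-]; have /ler_normlP[] := gC _ Ky; rewrite lerNl.
Qed.

Lemma node_max_ge K g x : nodes Q K x -> g x <= node_max Q K g.
Proof.
move=> Kx; apply: ub_le_sup; last by exists x.
have [C gC] := nodes_bounded K g.
by exists C => _ [y Ky <-]; have /ler_normlP[] := gC _ Ky.
Qed.

Lemma poly_space_squeeze theta (p : mpoly.mpoly d R) a :
  poly_space kd k p -> poly_space kd k (squeeze theta p a).
Proof.
move=> hp; apply: poly_space_linear; last exact: poly_spaceC.
by rewrite addrC -mpoly.mpolyCN -[p]scale1r addrC; apply: poly_space_linear => //;
  exact: poly_spaceC.
Qed.

Lemma peval_squeeze theta (p : mpoly.mpoly d R) a (x : 'rV[R]_d) :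
  peval (squeeze theta p a) x = theta * peval p x + (1 - theta) * a.
Proof.
rewrite peval_linear pevalC -[p]scale1r -mpoly.mpolyCN peval_linear pevalC.
by rewrite scale1r; ring.
Qed.

Lemma pavg_squeeze K theta (p : mpoly.mpoly d R) :
  poly_space kd k p -> pavg K (squeeze theta p (pavg K p)) = pavg K p.
Proof.
move=> hp; have hC := @poly_spaceC R d kd k.
rewrite /squeeze (pavg_linear Q) ?pavgC//; last first.
  by rewrite -mpoly.mpolyCN -[p in p + _]scale1r; exact: poly_space_linear.
rewrite -[p in p - _]scale1r -mpoly.mpolyCN (pavg_linear Q)// pavgC.
by rewrite mul1r subrr mulr0 add0r.
Qed.

(* [quot] returns 1 when the denominator vanishes; then z = a <= y and there is
   nothing to limit. *)
Lemma quot_squeeze_ge (lo y z a theta : R) : lo <= a -> z <= y ->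
  0 <= theta -> theta <= `|quot (lo - a) (z - a)| ->
  lo <= theta * y + (1 - theta) * a.
Proof.
move=> la zy t0 tq; have [ay|ya] := leP a y.
  by have : 0 <= theta * (y - a) by [rewrite mulr_ge0 ?subr_ge0]; lra.
have za : z - a < 0 by lra.
move: tq; rewrite /quot lt_eqF// normf_div (ltr0_norm za) ler0_norm ?subr_le0//.
rewrite ler_pdivlMr ?oppr_gt0// => tq; nra.
Qed.

Lemma quot_squeeze_le (hi y z a theta : R) : a <= hi -> y <= z ->
  0 <= theta -> theta <= `|quot (hi - a) (z - a)| ->
  theta * y + (1 - theta) * a <= hi.
Proof.
move=> ah yz t0 tq; have := @quot_squeeze_ge (- hi) (- y) (- z) (- a) theta.
rewrite !lerN2 -!opprD => /(_ ah yz t0).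
rewrite /quot oppr_eq0 !invrN mulrNN -/(quot _ _) => /(_ tq); lra.
Qed.

Lemma scalar_limiter_scaling (lo hi : R) :
  scaling_limiter Q (interval_region lo hi) (scalar_limiter Q lo hi).
Proof.
move=> K q _ hq ->; set theta := Num.min _ _.
have t0 : 0 <= theta by rewrite !le_min !normr_ge0 ler01.
split.
- by move=> i; rewrite ffunE; exact: poly_space_squeeze.
- by apply/rowP => i; rewrite !mxE ffunE (ord1 i) pavg_squeeze.
- move=> /andP[]; rewrite mxE => loa ahi x Kx.
  rewrite /interval_region /= mxE ffunE peval_squeeze; apply/andP; split.
    apply: quot_squeeze_ge loa (node_min_le _ Kx) t0 _.
    by rewrite !ge_min lexx ?orbT.
  apply: quot_squeeze_le ahi (node_max_ge _ Kx) t0 _.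
  by rewrite !ge_min lexx ?orbT.
Qed.

(** Brings the one-sided quotient of the Euler limiter to the form with absolute value taken by
    [quot_squeeze_ge]. *)
Lemma quot_theta (eps a z : R) : eps <= a -> z <= a ->
  let theta := Num.min 1 (quot (a - eps) (a - z)) in
  [/\ 0 <= theta, theta <= 1 & theta <= `|quot (eps - a) (z - a)|].
Proof.
move=> ea za theta; have q0 : 0 <= quot (a - eps) (a - z).
  by rewrite /quot; case: ifP => // _; apply: divr_ge0; rewrite subr_ge0.
split; [by rewrite le_min q0 ler01|by rewrite ge_min lexx|rewrite /theta ge_min].
rewrite -[eps - a]opprB -[z - a]opprB /quot oppr_eq0 invrN mulrNN.
by rewrite -/(quot _ _) (ger0_norm q0) lexx orbT.
Qed.

(** Jensen's inequality for a superlevel set: it contains the nodal values, hence their convex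
    combination. [P] restricts to states where [g] has convex superlevel sets, such as those of
    positive density. *)
Lemma node_min_le_cavg K m (q : @cpoly R d m) (g : 'rV[R]_m -> R) (P : set 'rV[R]_m) :
  in_space kd k q -> on_S Q P K q ->
  is_convex [set u | P u /\ node_min Q K (fun x => g (ceval q x)) <= g u] ->
  node_min Q K (fun x => g (ceval q x)) <= g (cavg K q).
Proof.
move=> hq Pq cvx; suff [] : [set u | P u /\
  node_min Q K (fun x => g (ceval q x)) <= g u] (cavg K q) by [].
apply: (on_S_cavg (Q := Q)) hq _; first exact: cvx.
by move=> x Kx; split; [exact: Pq|exact: (node_min_le (fun x => g (ceval q x)))].
Qed.

Section euler.
Implicit Types q : @cpoly R d (1 + d + 1).

Definition squeeze_rho K theta q : cpoly (1 + d + 1) :=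
  [ffun i => if i == rho_index then squeeze theta (q i) (cavg K q 0 i) else q i].

Definition squeeze_all K theta q : cpoly (1 + d + 1) :=
  [ffun i => squeeze theta (q i) (cavg K q 0 i)].

Lemma squeeze_rho_space K theta q :
  in_space kd k q -> in_space kd k (squeeze_rho K theta q).
Proof.
by move=> hq i; rewrite ffunE; case: ifP => // _; exact: poly_space_squeeze.
Qed.

Lemma cavg_squeeze_rho K theta q :
  in_space kd k q -> cavg K (squeeze_rho K theta q) = cavg K q.
Proof.
move=> hq; apply/rowP => i; rewrite !mxE ffunE; case: ifP => // _.
by rewrite mxE pavg_squeeze.
Qed.

Lemma rho_squeeze_rho K theta q (x : 'rV[R]_d) :
  rho (ceval (squeeze_rho K theta q) x) =
  theta * rho (ceval q x) + (1 - theta) * rho (cavg K q).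
Proof. by rewrite !rhoE !mxE ffunE eqxx peval_squeeze mxE. Qed.

Lemma squeeze_all_space K theta q :
  in_space kd k q -> in_space kd k (squeeze_all K theta q).
Proof. by move=> hq i; rewrite ffunE; exact: poly_space_squeeze. Qed.

Lemma cavg_squeeze_all K theta q :
  in_space kd k q -> cavg K (squeeze_all K theta q) = cavg K q.
Proof. by move=> hq; apply/rowP => i; rewrite !mxE ffunE mxE pavg_squeeze. Qed.

Lemma ceval_squeeze_all K theta q (x : 'rV[R]_d) :
  ceval (squeeze_all K theta q) x =
  theta *: ceval q x + (1 - theta) *: cavg K q.
Proof. by apply/rowP => i; rewrite !mxE ffunE peval_squeeze mxE. Qed.

(** The limiter squeezes about the average of the original polynomial both times; the density step
    keeps averages, so the second step also squeezes about the average of its own argument. *)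
Lemma euler_limiter_epsE eps K q : in_space kd k q ->
  exists theta1 theta2, [/\ theta1 = Num.min 1 (quot (rho (cavg K q) - eps)
       (rho (cavg K q) - node_min Q K (fun x => rho (ceval q x)))),
     theta2 = Num.min 1 (quot (rhoe (cavg K q) - eps) (rhoe (cavg K q) -
       node_min Q K (fun x => rhoe (ceval (squeeze_rho K theta1 q) x)))) &
     euler_limiter_eps Q eps K q = squeeze_all K theta2 (squeeze_rho K theta1 q)].
Proof.
move=> hq; do 2!eexists; split; first by []; first by [].
by rewrite /squeeze_all cavg_squeeze_rho.
Qed.

(** The first squeeze makes the density at least [eps] at the nodes; only then is [rhoe] concave on
    the states involved, which the second squeeze uses to reach [rhoe] >= [eps]. *)
Lemma euler_limiter_scaling (gamma : R) : 1 < gamma ->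
  scaling_limiter Q (euler_region gamma) (euler_limiter Q gamma).
Proof.
move=> g1 K q _ hq [eps [eps0 avg_eps ->]].
have [t1 [t2 [t1E t2E ->]]] := euler_limiter_epsE eps K hq.
set qh := squeeze_rho K t1 q in t2E *.
have hqh : in_space kd k qh by exact: squeeze_rho_space.
have aqh : cavg K qh = cavg K q by exact: cavg_squeeze_rho.
split; [exact: squeeze_all_space|by rewrite cavg_squeeze_all|].
move=> /avg_eps[]; set a := cavg K q in t1E t2E aqh *; move=> ra ea.
have t1b : node_min Q K (fun x => rho (ceval q x)) <= rho a.
  apply: (node_min_le_cavg (P := setT)) => //.
  by move=> u v t [_ ru] [_ rv] t0 t1'; split => //; exact: rho_superlevel_convex.
have [t10 t11 t1q] := quot_theta ra t1b; rewrite -t1E in t10 t11 t1q.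
have rqh x : nodes Q K x -> eps <= rho (ceval qh x).
  move=> Kx; rewrite rho_squeeze_rho; apply: quot_squeeze_ge ra _ t10 t1q.
  exact: (node_min_le (fun x => rho (ceval q x))).
have t2b : node_min Q K (fun x => rhoe (ceval qh x)) <= rhoe a.
  rewrite -aqh; apply: (node_min_le_cavg (P := [set u | 0 < rho u])) => //.
    by move=> x /rqh; exact: lt_le_trans.
  exact: rhoe_superlevel_convex.
have [t20 t21 t2q] := quot_theta ea t2b; rewrite -t2E in t20 t21 t2q.
move=> x Kx; rewrite ceval_squeeze_all aqh; apply/(euler_regionP _ g1).
have rx := lt_le_trans eps0 (rqh x Kx); have r0 := lt_le_trans eps0 ra.
have e_ge := rhoe_concave rx r0 t20 t21.
split; first by rewrite rho_linear rhoZ; have := rqh x Kx; nra.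
apply: lt_le_trans e_ge; apply: lt_le_trans eps0 _.
by apply: quot_squeeze_ge ea _ t20 t2q; exact: (node_min_le (fun x => rhoe (ceval qh x))).
Qed.

End euler.

End limiters.

(** * Closedness of low-dimensional cells *)

Section closed_cells.
Context {R : realType}.

(** The measure on R^0 is a unit mass, so the endpoints of an interval, as edges, have length 1. *)
Lemma vol_dim0 (A : set 'rV[R]_0) : (0 < vol A)%E -> vol A = 1%E.
Proof.
by rewrite /vol /= diracE; case: (_ \in _) => //=; rewrite ltxx.
Qed.

Lemma vol_dim1 (a b : R) : a <= b ->
  vol [set y : 'rV[R]_1 | a <= y 0 0 <= b] = (b - a)%:E.
Proof.
move=> ab; rewrite /vol /= /pushforward.
rewrite (_ : _ @^-1` _ = setT `*` `[a, b]); last first.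
  apply/seteqP; split => -[t x] /=; rewrite in_itv /= mxE (tnth_nth 0) //=.
  by case.
rewrite product_measure1E//= diracT mul1e lebesgue_measure_itv /= lte_fin.
case: ltP => // ba; rewrite (_ : b - a = 0)//; lra.
Qed.

(** For small t > 0 the point x - t nu stays in the cell, hence on the given side. This fixes the
    sign of a normal known up to sign; x must avoid the other faces because [normal_outer] speaks
    only of such points. *)
Lemma normal_side d (M : mesh R d) (e : edge M) (x p N : 'rV[R]_d) :
  face e x ->
  (forall e', e' != e -> owner e' = owner e -> ~ face e' x) ->
  (forall y, body (owner e) y -> dotv N (y - p) <= 0) -> dotv N (x - p) = 0 ->
  0 <= dotv N (normal e).
Proof.
move=> ex ne side Nx.
have [t [t0 [/side xt _]]] :=
  filter_ex (filterI (nbhs_right_gt (0 : R)) (normal_outer ex ne)).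
move: xt; rewrite -addrA [- _ - p]addrC addrA dotvDr Nx add0r -scaleNr dotvZr.
by rewrite mulNr oppr_le0 pmulr_rge0.
Qed.

Definition segment d (p q : 'rV[R]_d) : set 'rV[R]_d :=
  [set x | exists2 t : R, 0 <= t <= 1 & x = p + t *: (q - p)].

Lemma segment_chart (n : nat) (F : 'rV[R]_n) (o p q : 'rV[R]_n) (yp yq : R) :
  dotv F F = 1 -> p = o + yp *: F -> q = o + yq *: F -> yp <= yq ->
  [set y : 'rV[R]_1 | segment p q (o + y *m F)] =
  [set y : 'rV[R]_1 | yp <= y 0 0 <= yq].
Proof.
move=> F1 -> -> ypq; apply/seteqP; split => y /=.
  rewrite [y]mx11_scalar mul_scalar_mx => -[t /andP[t0 t1]].
  rewrite opprD addrACA subrr add0r -scalerBl scalerA -addrA -scalerDl.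
  move=> /addrI /(congr1 (fun x => dotv x F)); rewrite !dotvZl F1 !mulr1 !mxE eqxx mulr1n.
  by move=> ->; apply/andP; split; nra.
rewrite [y in o + y *m F]mx11_scalar mul_scalar_mx => /andP[].
set z := y 0 0 => pz zq; move: ypq; rewrite le_eqVlt => /predU1P[ypq|ypq].
  exists 0; rewrite ?lexx ?ler01// scale0r addr0; congr (_ + _ *: _).
  by apply/eqP; rewrite eq_le pz ypq zq.
exists ((z - yp) / (yq - yp)).
  rewrite ler_pdivrMr ?subr_gt0// mul1r; apply/andP; split; last lra.
  by apply: divr_ge0; lra.
rewrite opprD addrACA subrr add0r -scalerBl scalerA -addrA -scalerDl.
by congr (_ + _ *: _); field; rewrite subr_eq0 gt_eqF.
Qed.

Lemma segmentC d (p q : 'rV[R]_d) : segment p q = segment q p.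
Proof.
suff H (p' q' : 'rV[R]_d) : segment p' q' `<=` segment q' p' by apply/seteqP; split; exact: H.
move=> _ [t /andP[t0 t1] ->]; exists (1 - t).
  by apply/andP; split; lra.
by apply/rowP => i; rewrite !mxE; ring.
Qed.

(** By flatness both endpoints lie on the chart line; [s] is the difference of their parameters,
    signed because the chart may run along the edge in either direction. *)
Lemma edge_len_segment (M : mesh R 2) (e : edge M) (p q : 'rV[R]_2) :
  face e = segment p q -> exists s : R,
    q - p = s *: (chart_frame e : 'rV[R]_2) /\ edge_len e = `|s|.
Proof.
move=> fE; set F := chart_frame e; have F1 : dotv F F = 1.
  by have /matrixP/(_ 0 0) := frame_isometric e; rewrite !mxE; under eq_bigr do rewrite mxE.
have onF x : face e x -> exists y, x = chart_origin e + y *: (F : 'rV[R]_2).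
  by move=> /face_flat[y _ <-]; exists (y 0 0); rewrite {1}[y]mx11_scalar mul_scalar_mx.
have [|yp pE] := onF p.
  by rewrite fE; exists 0; rewrite ?lexx ?ler01// scale0r addr0.
have [|yq qE] := onF q.
  by rewrite fE; exists 1; rewrite ?lexx ?ler01// scale1r subrKC.
exists (yq - yp); split; first by rewrite pE qE opprD addrACA subrr add0r scalerBl.
rewrite /edge_len /in_chart fE; have [ypq|yqp] := leP yp yq.
  by rewrite (segment_chart F1 pE qE)// vol_dim1//= ger0_norm ?subr_ge0.
rewrite segmentC (segment_chart F1 qE pE) ?ltW// vol_dim1 ?ltW//=.
by rewrite ltr0_norm ?subr_lt0// opprB.
Qed.

Lemma dotv2 (x y : 'rV[R]_2) : dotv x y = x 0 0 * y 0 0 + x 0 1 * y 0 1.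
Proof.
rewrite /dotv !big_ord_recl big_ord0 addr0.
by have -> : lift ord0 ord0 = 1 :> 'I_2 by exact/val_inj.
Qed.

Lemma rowP2 (x y : 'rV[R]_2) : x 0 0 = y 0 0 -> x 0 1 = y 0 1 -> x = y.
Proof.
move=> h0 h1; apply/rowP => i; case: i => [[|[|//]] hi].
  by rewrite (_ : Ordinal hi = 0)//; exact/val_inj.
by rewrite (_ : Ordinal hi = 1)//; exact/val_inj.
Qed.

Lemma orthonormal2 (F nu N : 'rV[R]_2) : dotv F F = 1 -> dotv nu nu = 1 ->
  dotv F nu = 0 -> dotv N F = 0 -> N = dotv N nu *: nu.
Proof.
rewrite !dotv2.
set a := F 0 0; set b := F 0 1; set c := nu 0 0; set e := nu 0 1.
set x := N 0 0; set y := N 0 1 => F1 nu1 Fnu NF.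
(* The cross product of [N] and [nu], multiplied by |F|^2 = 1, is a combination of N.F and F.nu. *)
have par : x * e - y * c = 0.
  rewrite -[LHS]mul1r -F1 (_ : _ * _ = a * (e * (x * a + y * b) - y * (a * c + b * e)) +
    b * (x * (a * c + b * e) - c * (x * a + y * b))); last by ring.
  by rewrite Fnu NF !mulr0 subrr !mulr0 addr0.
apply: rowP2; rewrite mxE -/x -/y -/c -/e.
  rewrite -[LHS]mulr1 -nu1 -[RHS]addr0 -(mulr0 e) -par; ring.
by rewrite -[LHS]mulr1 -nu1 -[RHS]subr0 -(mulr0 c) -par; ring.
Qed.

(** In the plane a vector orthogonal to the edge is a multiple of its normal. The equality of
    lengths determines the multiple up to sign, and [normal_side] at the midpoint decides the
    sign. *)
Lemma edge_len_normal2 (M : mesh R 2) (e : edge M) (p q N : 'rV[R]_2) :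
  face e = segment p q -> dotv N (q - p) = 0 ->
  dotv N N = dotv (q - p) (q - p) ->
  (forall y, body (owner e) y -> dotv N (y - p) <= 0) ->
  (forall e', e' != e -> owner e' = owner e -> ~ face e' (p + 2^-1 *: (q - p))) ->
  edge_len e *: normal e = N.
Proof.
move=> fE Nqp NN side mid; have [s [qpE ->]] := edge_len_segment fE.
set F := chart_frame e in qpE; have F1 : dotv F F = 1.
  by have /matrixP/(_ 0 0) := frame_isometric e; rewrite !mxE; under eq_bigr do rewrite mxE.
have Fnu : dotv F (normal e) = 0.
  by have /matrixP/(_ 0 0) := frame_normal e; rewrite !mxE; under eq_bigr do rewrite mxE.
rewrite qpE dotvZl dotvZr F1 mulr1 -expr2 in NN.
have [s0|s0] := eqVneq s 0.
  rewrite s0 normr0 scale0r; apply/esym.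
  move: NN; rewrite s0 expr0n /= dotv2 => /eqP.
  by rewrite paddr_eq0 -?expr2 ?sqr_ge0// !sqrf_eq0 => /andP[/eqP ? /eqP ?];
    apply: rowP2; rewrite mxE.
have NF : dotv N F = 0.
  by move: Nqp => /eqP; rewrite qpE dotvZr mulf_eq0 (negPf s0) => /eqP.
have nu1 := normal_unit e.
have NE := orthonormal2 F1 nu1 Fnu NF.
have k0 : 0 <= dotv N (normal e).
  apply: (normal_side _ mid side); last by rewrite addrC addKr dotvZr Nqp mulr0.
  by rewrite fE; exists 2^-1 => //; apply/andP; split; lra.
rewrite [RHS]NE; congr (_ *: _).
move: NN; rewrite {1 2}NE dotvZl dotvZr nu1 mulr1 -expr2 => /eqP.
by rewrite eqf_sqr => /orP[/eqP <-|/eqP sE]; [rewrite ger0_norm|rewrite -normrN -sE ger0_norm].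
Qed.

Lemma edge_len_normal1 (M : mesh R 1) (e : edge M) (p N : 'rV[R]_1) :
  face e = [set p] -> dotv N N = 1 ->
  (forall y, body (owner e) y -> dotv N (y - p) <= 0) ->
  (forall e', e' != e -> owner e' = owner e -> ~ face e' p) ->
  edge_len e *: normal e = N.
Proof.
move=> fE NN side mid.
have -> : edge_len e = 1.
  by rewrite /edge_len vol_dim0//; case/andP: (face_area e).
have : 0 <= dotv N (normal e).
  apply: (normal_side _ mid side); first by rewrite fE.
  by rewrite subrr -(scale0r 0) dotvZr mul0r.
have := normal_unit e; rewrite scale1r; move: NN.
rewrite /dotv !big_ord_recl !big_ord0 !addr0 => N1 n1 Nn.
apply/rowP => i; rewrite (ord1 i); set x := N 0 0 in N1 Nn *.
set y := normal e 0 0 in n1 Nn *.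
move/eqP: N1; rewrite -expr2 sqrf_eq1 => /orP[]/eqP xE;
  move/eqP: n1; rewrite -expr2 sqrf_eq1 => /orP[]/eqP yE; rewrite xE yE in Nn *; lra.
Qed.

End closed_cells.

(** * Weighted normals of intervals, rectangles and triangles *)

Section low_dimension.
Context {R : realType}.

Lemma sum_cell_edges d (M : mesh R d) (K : cell M) (I : finType) (phi : I -> edge M)
    (V : nmodType) (G : edge M -> V) :
  injective phi -> (forall e, owner e = K <-> exists i, e = phi i) ->
  \sum_(e | owner e == K) G e = \sum_i G (phi i).
Proof.
move=> phi_inj phiK; rewrite -(big_imset (h := phi) G (A := predT)) /=; last first.
  by move=> i j _ _; exact: phi_inj.
apply: eq_bigl => e; apply/eqP/imsetP => [/phiK[i ->]|[i _ ->]]; first by exists i.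
by apply/phiK; exists i.
Qed.

(** Supplies the points lying on a single face that [normal_side] asks for. *)
Lemma box_isolated d (M : mesh R d) (K : cell M) (lo hi x : 'rV[R]_d)
    (phi : 'I_d * bool -> edge M) (i : 'I_d) (b : bool) :
  (forall i, lo 0 i < hi 0 i) ->
  (forall e, owner e = K <-> exists ib, e = phi ib) ->
  (forall ib, face (phi ib) =
     body K `&` [set x | x 0 ib.1 = if ib.2 then hi 0 ib.1 else lo 0 ib.1]) ->
  x 0 i = (if b then hi 0 i else lo 0 i) ->
  (forall j, j != i -> lo 0 j < x 0 j < hi 0 j) ->
  forall e, e != phi (i, b) -> owner e = K -> ~ face e x.
Proof.
move=> lohi phiK faceE xi xj e + /phiK[[i' b'] eE]; rewrite {}eE faceE => ne [_ /=].
have [ii'|/xj/andP[l h]] := eqVneq i' i; last by case: (b') => E; lra.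
have bb' : b' != b by apply: contra ne => /eqP ->; rewrite ii'.
by rewrite ii' xi; move: bb'; have := lohi i; case: b b' {ne xi} => -[] //= lh _ E;
  by move: lh; rewrite E ltxx.
Qed.

(** Addition in ['I_2] is modulo 2, so i + 1 is the other axis and both pairs of sides of a
    rectangle are treated at once. *)
Lemma ord2_other (i : 'I_2) :
  [/\ i + 1 != i,
      forall x y : 'rV[R]_2, dotv x y = x 0 i * y 0 i + x 0 (i + 1) * y 0 (i + 1) &
      forall l, l = i \/ l = i + 1].
Proof.
have I2 (l : 'I_2) : l = 0 \/ l = 1.
  by case: l => [[|[|//]] h]; [left|right]; exact/val_inj.
have e11 : 1 + 1 = 0 :> 'I_2 by exact/val_inj.
have [->|->] := I2 i; rewrite ?add0r ?e11; split => //.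
- by move=> x y; rewrite dotv2.
- by move=> x y; rewrite dotv2 addrC.
- by move=> l; have [->|->] := I2 l; [right|left].
Qed.

Definition box_sign (b : bool) : R := if b then 1 else -1.

Lemma box_closed d (M : mesh R d) (K : cell M) : d = 1%N \/ d = 2%N -> box_cell K ->
  \sum_(e | owner e == K) edge_len e *: normal e = 0.
Proof.
move=> d12 [lo [hi [phi [lohi bodyE phi_inj phiK faceE]]]].
(* [A i] is the measure of the faces orthogonal to axis i: 1 in dimension one, the length of the
   other side in dimension two. Opposite faces then cancel. *)
suff [A edgeE] : exists A : 'I_d -> R, forall ib,
    edge_len (phi ib) *: normal (phi ib) =
    (box_sign ib.2 * A ib.1) *: delta_mx 0 ib.1.
  rewrite (sum_cell_edges _ phi_inj phiK); under eq_bigr do rewrite edgeE.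
  rewrite -(pair_bigA _ (fun i b => (box_sign b * A i) *: delta_mx 0 i)) big1// => i _.
  by rewrite big_bool /= mul1r mulN1r scaleNr subrr.
have ownerE ib : owner (phi ib) = K by apply/phiK; exists ib.
have delta_side (x p : 'rV[R]_d) i b (c : R) : body K x -> 0 <= c ->
    p 0 i = (if b then hi 0 i else lo 0 i) ->
    dotv ((box_sign b * c) *: delta_mx 0 i) (x - p) <= 0.
  rewrite bodyE => Kx c0 pE; have /andP[lx hx] := Kx i.
  rewrite dotvZl (dotvC (delta_mx _ _)) dotv_delta !mxE pE.
  by rewrite /box_sign; case: (b); nra.
case: d12 => dE.
- subst d; exists (fun=> 1) => -[i b] /=; rewrite mulr1 (ord1 i).
  apply: (edge_len_normal1 (p := if b then hi else lo)).
  + rewrite faceE bodyE; apply/seteqP; split => x /=.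
      by move=> [_ xE]; apply/rowP => j; rewrite (ord1 j) xE; case: (b).
    move=> ->; split => [j|]; last by case: (b).
    by rewrite (ord1 j); have /ltW := lohi 0; case: (b); rewrite lexx ?andbT.
  + by rewrite dotvZr dotv_delta !mxE eqxx /box_sign; case: (b); rewrite ?mulr1 ?mulrNN ?mulr1.
  + move=> y; rewrite ownerE => Ky; rewrite -[box_sign b]mulr1.
    by apply: delta_side => //; case: (b).
  + move=> e ne; rewrite ownerE.
    apply: (box_isolated lohi phiK faceE _ _ ne); first by case: (b).
    by move=> j; rewrite (ord1 j).
- subst d; exists (fun i => hi 0 (i + 1) - lo 0 (i + 1)) => -[i b] /=.
  have [ji dotE ijP] := ord2_other i; set j := i + 1 in ji dotE ijP *.
  have lhj := lohi j; set c := if b then hi 0 i else lo 0 i.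
  (* The side on which coordinate [i] equals [c] runs from [corner lo] to [corner hi]. *)
  pose corner (y : 'rV[R]_2) := \row_l (if l == i then c else y 0 l).
  have ci y : corner y 0 i = c by rewrite mxE eqxx.
  have cj y : corner y 0 j = y 0 j by rewrite mxE (negPf ji).
  have A0 : 0 <= hi 0 j - lo 0 j by lra.
  apply: (edge_len_normal2 (p := corner lo) (q := corner hi)).
  + rewrite faceE bodyE; apply/seteqP; split => [x [Kx /= xi]|_ [t /andP[t0 t1] ->]].
      have /andP[lx hx] := Kx j; exists ((x 0 j - lo 0 j) / (hi 0 j - lo 0 j)).
        rewrite ler_pdivrMr ?subr_gt0// mul1r; apply/andP; split; last lra.
        by apply: divr_ge0; lra.
      apply/rowP => l; have [->|->] := ijP l.
        by rewrite !mxE !eqxx subrr mulr0 addr0.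
      by rewrite !mxE !(negPf ji); field; rewrite subr_eq0 gt_eqF.
    have xi : (corner lo + t *: (corner hi - corner lo)) 0 i = c.
      by rewrite !mxE !eqxx subrr mulr0 addr0.
    split => //= l; have [->|->] := ijP l.
      by rewrite xi /c; have /ltW := lohi i; case: (b); rewrite lexx ?andbT.
    by rewrite !mxE !(negPf ji); apply/andP; split; nra.
  + by rewrite dotvZl dotvC dotv_delta !mxE !eqxx subrr mulr0.
  + rewrite dotvZl dotvZr dotv_delta dotE !mxE !eqxx !(negPf ji) subrr mul0r add0r.
    by rewrite /= mulr1 /box_sign; case: (b); ring.
  + by move=> y; rewrite ownerE => Ky; apply: delta_side.
  + move=> e ne; rewrite ownerE.
    apply: (box_isolated lohi phiK faceE _ _ ne).
      by rewrite !mxE !eqxx subrr mulr0 addr0.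
    move=> l li; have [lE|->] := ijP l; first by rewrite lE eqxx in li.
    by rewrite !mxE !(negPf ji); apply/andP; split; lra.
Qed.

Definition perp (z : 'rV[R]_2) : 'rV[R]_2 :=
  \row_l (if l == 0 then z 0 1 else - z 0 0).

Definition cross (y z : 'rV[R]_2) : R := y 0 0 * z 0 1 - y 0 1 * z 0 0.

Lemma dotv_perp y z : dotv (perp y) z = - cross y z.
Proof. by rewrite dotv2 !mxE /= /cross; ring. Qed.

(** Addition is modulo 3: starting from any vertex, adding 1 goes round the triangle, so one
    argument serves all three edges. *)
Lemma ord3_rot (i : 'I_3) :
  [/\ uniq [:: i; i + 1; i + 1 + 1], i + 1 + 1 + 1 = i,
      forall l, [\/ l = i, l = i + 1 | l = i + 1 + 1] &
      forall (V : nmodType) (F : 'I_3 -> V),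
        \sum_l F l = F i + F (i + 1) + F (i + 1 + 1)].
Proof.
have I3 (l : 'I_3) : [\/ l = 0, l = 1 | l = 1 + 1].
  by case: l => [[|[|[|//]]] h]; [constructor 1|constructor 2|constructor 3];
    exact: val_inj.
have e3 : 1 + 1 + 1 = 0 :> 'I_3 by exact/val_inj.
have S3 (V : nmodType) (F : 'I_3 -> V) : \sum_l F l = F 0 + F 1 + F (1 + 1).
  rewrite !big_ord_recl big_ord0 addr0 addrA.
  by congr (_ + F _ + F _); exact: val_inj.
have [->|->|->] := I3 i; rewrite ?add0r ?e3 ?add0r; split => //.
- by move=> l; have [->|->|->] := I3 l; [constructor 3|constructor 1|constructor 2].
- by move=> V F; rewrite S3 -addrA addrC.
- by move=> l; have [->|->|->] := I3 l; [constructor 2|constructor 3|constructor 1].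
- by move=> V F; rewrite S3 -[RHS]addrA addrC.
Qed.

Lemma det_mx22 (A : 'M[R]_2) : \det A = A 0 0 * A 1 1 - A 0 1 * A 1 0.
Proof.
rewrite (expand_det_row _ 0) !big_ord_recl big_ord0 addr0 /cofactor !det_mx11 !mxE.
have -> : lift 0 0 = 1 :> 'I_2 by exact: val_inj.
have -> : lift 1 0 = 0 :> 'I_2 by exact: val_inj.
by rewrite /= expr0 expr1; ring.
Qed.

(** The weighted normal of an edge is its edge vector turned by a right angle, with a sign common to
    all edges; edge vectors add up to zero round the triangle. *)
Lemma simplex_closed (M : mesh R 2) (K : cell M) : simplex_cell K ->
  \sum_(e | owner e == K) edge_len e *: normal e = 0.
Proof.
move=> [v [phi [vfree bodyE phi_inj phiK faceE]]].
(* Twice the signed area of the triangle. Its sign [s] makes the turned edge vectors point outward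
   for either orientation. *)
pose D := cross (v 1 - v 0) (v (1 + 1) - v 0).
have D0 : D != 0.
  move: vfree; rewrite row_free_unit unitmxE unitfE; congr (_ != 0).
  rewrite det_mx22 !mxE /D /cross !mxE.
  have -> : ord0 = 0 :> 'I_3 by [].
  have -> : lift 0 0 = 1 :> 'I_3 by exact: val_inj.
  by have -> : lift 0 1 = 1 + 1 :> 'I_3 by exact: val_inj.
have crossE i : cross (v (i + 1) - v i) (v (i + 1 + 1) - v i) = D.
  have e3 : 1 + 1 + 1 = 0 :> 'I_3 by exact: val_inj.
  have [_ _ + _] := ord3_rot 0; rewrite add0r => /(_ i)[] ->;
    rewrite ?e3 ?add0r // /D /cross !mxE; ring.
pose s : R := Num.sg D.
have sD : s * D = `|D| by rewrite normrEsg.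
have s2 : s * s = 1 by rewrite -expr2 sqr_sg D0.
pose N i := s *: perp (v (i + 1 + 1) - v (i + 1)).
have N_face i : dotv (N i) (v (i + 1 + 1) - v (i + 1)) = 0.
  by rewrite dotvZl dotv_perp /cross; ring.
have N_vertex i : dotv (N i) (v i - v (i + 1)) = - `|D|.
  have [_ i3 _ _] := ord3_rot i.
  by rewrite dotvZl dotv_perp mulrN -sD -(crossE (i + 1)) i3.
(* This measures position relative to edge i by the barycentric coordinate [c i]: it yields both the
   outward direction of [N i] and the separation of an edge midpoint from the other edges. *)
have N_bary i c : \sum_l c l = 1 ->
    dotv (N i) (\sum_l c l *: v l - v (i + 1)) = - (c i * `|D|).
  have [_ _ _ sumE] := ord3_rot i; rewrite !sumE => c1.
  rewrite (_ : _ - v (i + 1) = c i *: (v i - v (i + 1)) +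
     c (i + 1 + 1) *: (v (i + 1 + 1) - v (i + 1))).
    by rewrite dotvDr !dotvZr N_face N_vertex mulr0 addr0 mulrN.
  have -> : c (i + 1) = 1 - c i - c (i + 1 + 1) by rewrite -c1; ring.
  by apply/rowP => l; rewrite !mxE; ring.
have ownerE i : owner (phi i) = K by apply/phiK; exists i.
rewrite (sum_cell_edges _ phi_inj phiK).
rewrite (eq_bigr (fun i => s *: perp (v (i + 1 + 1)) - s *: perp (v (i + 1)))).
  rewrite sumrB; apply/eqP; rewrite subr_eq0; apply/eqP.
  by rewrite [RHS](reindex_inj (addIr 1)).
move=> i _; have [/= uq i3 iP sumE] := ord3_rot i.
rewrite -scalerBr (_ : perp _ - perp _ = perp (v (i + 1 + 1) - v (i + 1))); last first.
  by apply: rowP2; rewrite !mxE /=; ring.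
move: uq; rewrite !inE negb_or andbT => /andP[/andP[/negPf i1 /negPf i2] /negPf i12].
rewrite eq_sym in i1; rewrite eq_sym in i2; rewrite eq_sym in i12.
apply: (edge_len_normal2 (p := v (i + 1)) (q := v (i + 1 + 1))).
- rewrite faceE; apply/seteqP; split => [x [c [c0 ci c1 ->]]|x [t /andP[t0 t1] ->]].
    have ci0 : c i = 0 by apply: ci; rewrite negbK.
    rewrite !sumE ci0 add0r in c1 *; exists (c (i + 1 + 1)).
      by apply/andP; split => //; rewrite -c1 lerDr.
    have -> : c (i + 1) = 1 - c (i + 1 + 1) by rewrite -c1 addrK.
    by apply/rowP => l; rewrite !mxE; ring.
  exists (fun l => if l == i then 0 else if l == i + 1 then 1 - t else t); split.
  + by move=> l; case: eqP => // _; case: eqP => // _; lra.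
  + by move=> l; rewrite negbK => ->.
  + by rewrite sumE !eqxx i1 i2 i12; ring.
  + rewrite sumE !eqxx i1 i2 i12.
    by apply/rowP => l; rewrite !mxE; ring.
- exact: N_face.
- rewrite /N dotvZl dotvZr mulrA s2 mul1r !dotv2 !mxE /=; ring.
- move=> y; rewrite ownerE bodyE => -[c [c0 _ c1 ->]].
  by rewrite N_bary// oppr_le0 mulr_ge0.
- move=> e ne; rewrite ownerE => /phiK[i' eE]; rewrite eE faceE => -[c [_ ci' c1]].
  have i'i : i' != i by apply: contra ne => /eqP <-; rewrite eE.
  (* Barycentric coordinates of the midpoint of edge i: on another edge the coordinate at i' would
     vanish, whereas here it is 1/2. *)
  pose h l : R := if l == i then 0 else 2^-1.
  have -> : v (i + 1) + 2^-1 *: (v (i + 1 + 1) - v (i + 1)) = \sum_l h l *: v l.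
    rewrite sumE /h !eqxx i1 i2.
    by apply/rowP => l; rewrite !mxE; field.
  move=> /(congr1 (fun z => dotv (N i') (z - v (i' + 1)))).
  rewrite !N_bary// ?ci' ?negbK//; last first.
    by rewrite sumE /h !eqxx i1 i2; field.
  rewrite /h (negPf i'i) mul0r oppr0 => /eqP; rewrite oppr_eq0 mulf_eq0 normr_eq0.
  by rewrite (negPf D0) orbF invr_eq0 pnatr_eq0.
Qed.

Lemma closed_cell d (M : mesh R d) : low_dim_mesh M -> forall K : cell M,
  \sum_(e | owner e == K) edge_len e *: normal e = 0.
Proof.
move=> [[dE box] K|[dE [box|tri]] K]; first by apply: box_closed => //; left.
  by apply: box_closed => //; right.
by move: M K tri; rewrite dE => M K /(_ K); exact: simplex_closed.
Qed.

End low_dimension.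

(** * Scalar laws *)

Section scalar_law.
Context {R : realType} {d : nat}.

Lemma is_derive_scalar (F : 'rV[R]_1 -> 'rV[R]_1) (s : R) :
  differentiable F s%:M ->
  is_derive s 1 (fun x : R => F x%:M 0 0) (jacobian F s%:M 0 0).
Proof.
move=> dF; have dv : derivable F s%:M 1%:M by exact: diff_derivable.
have E : (fun h : R => h^-1 *: (((fun x : R => F x%:M 0 0) \o shift s) (h *: 1) - F s%:M 0 0)) =
  (fun h => h^-1 *: (((fun x => F x 0 0) \o shift s%:M) (h *: 1%:M) - F s%:M 0 0)).
  by apply/funext => h; rewrite /= scale_scalar_mx -raddfD.
split; first by have /derivable_mxP/(_ 0 0) := dv; rewrite /derivable -E.
rewrite /derive E -/(derive _ _ _).
have := deriveEjacobian 1%:M dF; rewrite derive_mx// mul1mx => /matrixP/(_ 0 0).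
by rewrite mxE.
Qed.

Lemma lipschitz_of_derive (g dg : R -> R) (a0 x y : R) : x <= y ->
  (forall z, z \in `[x, y] -> is_derive z 1 g (dg z)) ->
  (forall z, z \in `[x, y] -> `|dg z| <= a0) ->
  `|g y - g x| <= a0 * (y - x).
Proof.
move=> xy der bnd.
have der' z : z \in `]x, y[ -> is_derive z 1 g (dg z).
  by move=> /subset_itv_oo_cc; exact: der.
have cg : {within `[x, y], continuous g}.
  by apply: derivable_within_continuous => z /der [].
have [z zxy ->] := MVT_segment xy der' cg.
rewrite normrM (ger0_norm (_ : 0 <= y - x)) ?subr_ge0// ler_wpM2r ?subr_ge0//.
exact: bnd.
Qed.

(** A 1 x 1 Jacobian has its entry as eigenvalue, so the bound on wave speeds bounds the derivative,
    and the mean value theorem applies. *)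
Lemma scalar_lipschitz (f : @flux R d 1) (nu : 'rV[R]_d) (lo hi a0 x y : R) :
  C1_flux f (interval_region lo hi) ->
  (forall u lam, interval_region lo hi u ->
    eigenvalue (jacobian (nflux f nu) u) lam -> `|lam| <= a0) ->
  lo <= x -> x <= y -> y <= hi ->
  `|nflux f nu y%:M 0 0 - nflux f nu x%:M 0 0| <= a0 * (y - x).
Proof.
move=> fC1 eig lx xy yh.
have int z : z \in `[x, y] -> interval_region lo hi (z%:M : 'rV[R]_1).
  rewrite in_itv /interval_region /= mxE eqxx mulr1n => /andP[xz zy].
  by apply/andP; split; lra.
have der z : z \in `[x, y] -> is_derive z 1 (fun s : R => nflux f nu s%:M 0 0)
    (jacobian (nflux f nu) z%:M 0 0).
  by move=> /int Bz; apply: is_derive_scalar; exact: C1_flux_differentiable fC1 Bz.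
apply: lipschitz_of_derive der _ => // z /int Bz; apply: (eig _ _ Bz).
apply/eigenvalueP; exists 1%:M; last by apply/eqP => /matrixP/(_ 0 0)/eqP; rewrite !mxE oner_eq0.
by rewrite mul1mx scale_scalar_mx mulr1 -mx11_scalar.
Qed.

Context {M : mesh R d} {kd : poly_kind} {k : nat} (Q : quadrature M kd k).

(** The boundary weights on each edge sum to 1, so the flux terms add up to a multiple of f(c)
    applied to the sum of the weighted normals. *)
Lemma constant_state_step m (f : @flux R d m) (t : R) (K : cell M) (c : 'rV[R]_m) :
  \sum_(e | owner e == K) edge_len e *: normal e = 0 ->
  \sum_(al < nI Q K) wI al *: c + \sum_(e | owner e == K) \sum_(be < nE Q e)
     wE be *: (c - edge_step t be *: nflux f (normal e) c) = c.
Proof.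
move=> closed; under [X in _ + X]eq_bigr do under eq_bigr do rewrite scalerBr.
under [X in _ + X]eq_bigr do rewrite sumrB; rewrite sumrB addrA.
rewrite -scaler_suml; under [X in _ + X - _]eq_bigr do rewrite -scaler_suml.
rewrite -scaler_suml -scalerDl (weight_sum Q) scale1r.
rewrite (_ : \sum_(e | _) _ = (t / cell_vol K) *:
   \sum_j (\sum_(e | owner e == K) edge_len e *: normal e) 0 j *: f j c).
  by rewrite closed big1 ?scaler0 ?subr0// => j _; rewrite mxE scale0r.
under [X in _ = _ *: X]eq_bigr do rewrite summxE scaler_suml.
rewrite exchange_big scaler_sumr; apply: eq_bigr => e /eqP eK.
rewrite (eq_bigr (fun be => (t / cell_vol K * edge_len e) *: (wB be *: nflux f (normal e) c))).
  rewrite -scaler_sumr -scaler_suml wB_sum scale1r /nflux -scalerA scaler_sumr.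
  by congr (_ *: _); apply: eq_bigr => j _; rewrite mxE scalerA.
move=> be _; rewrite !scalerA; congr (_ *: _).
rewrite /edge_step eK; field.
by rewrite (gt_eqF (wE_gt0 be)) (gt_eqF (cell_vol_gt0 K)).
Qed.

Lemma nodal_sum_le (K : cell M) (p p' : 'I_(nI Q K) -> 'rV[R]_1)
    (q q' : forall e, 'I_(nE Q e) -> 'rV[R]_1) :
  (forall al, p al 0 0 <= p' al 0 0) ->
  (forall e be, owner e = K -> q e be 0 0 <= q' e be 0 0) ->
  (\sum_al wI al *: p al +
     \sum_(e | owner e == K) \sum_be wE be *: q e be) 0 0 <=
  (\sum_al wI al *: p' al +
     \sum_(e | owner e == K) \sum_be wE be *: q' e be) 0 0.
Proof.
move=> pp qq; rewrite !mxE !summxE; apply: lerD; apply: ler_sum => i Ki.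
  by rewrite !mxE ler_wpM2l// wI_ge0.
rewrite !summxE; apply: ler_sum => be _.
by rewrite !mxE ler_pM2l ?wE_gt0//; apply: qq; exact/eqP.
Qed.

(* A single edge step may leave the interval; but it is monotone in the state, and
   for a constant state the edge contributions of a closed cell cancel. *)
Lemma scalar_weak_G (bc : bdata M 1) (f : flux 1) (lo hi : R) :
  low_dim_mesh M -> C1_flux f (interval_region lo hi) ->
  weak_G Q bc f (interval_region lo hi) (fun=> interval_region lo hi).
Proof.
move=> lowM fC1 t a0 u w uV Gw a00 a0ub cfl Bu K.
rewrite (cavg_G_step K t uV Gw).
(* The flux is Lipschitz with constant [a0], and |[edge_step]| [a0] <= 1, so the flux term cannot
   outweigh the increase of the state. *)
have mono e (be : 'I_(nE Q e)) x y : lo <= x -> x <= y -> y <= hi ->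
    x - edge_step t be * nflux f (normal e) x%:M 0 0 <=
    y - edge_step t be * nflux f (normal e) y%:M 0 0.
  move=> lx xy yh.
  have eig v lam : interval_region lo hi v ->
      eigenvalue (jacobian (nflux f (normal e)) v) lam -> `|lam| <= a0.
    by move=> Bv elam; apply: a0ub; exists e, v, lam.
  have := scalar_lipschitz fC1 eig lx xy yh.
  have := edge_step_cfl be (ltW a00) cfl.
  set kap := edge_step t be; set g := nflux _ _ y%:M 0 0; set h := nflux _ _ x%:M 0 0.
  move=> k1 gh; rewrite -subr_ge0.
  have : `|kap * (g - h)| <= y - x.
    rewrite normrM; apply: le_trans (_ : `|kap| * (a0 * (y - x)) <= _).
      by rewrite ler_wpM2l.
    by rewrite mulrA ler_piMl// subr_ge0.
  by rewrite ler_norml => /andP[_]; lra.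
have closed c := constant_state_step f t c (closed_cell lowM K).
have EI (v : 'rV[R]_1) e (be : 'I_(nE Q e)) :
    (v - edge_step t be *: nflux f (normal e) v) 0 0 =
    v 0 0 - edge_step t be * nflux f (normal e) (v 0 0)%:M 0 0.
  by rewrite !mxE -mx11_scalar.
have Bint e (be : 'I_(nE Q e)) : lo <= (u_int u be) 0 0 <= hi.
  by apply: Bu; exact: nodesE.
have BI (al : 'I_(nI Q K)) : lo <= (ceval (u K) (xI al)) 0 0 <= hi.
  by apply: Bu; exact: nodesI.
have diag c : (c%:M : 'rV[R]_1) 0 0 = c by rewrite mxE eqxx mulr1n.
apply/andP; split.
(* The bound itself is the sum for the constant state [lo], which is then compared node by node. *)
- rewrite -[leLHS]diag -[lo%:M]closed.
  apply: nodal_sum_le => [al|e be _]; rewrite ?EI diag; first by case/andP: (BI al).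
  by have /andP[lu uh] := Bint e be; exact: mono.
- rewrite -[leRHS]diag -[hi%:M]closed.
  apply: nodal_sum_le => [al|e be _]; rewrite ?EI diag; first by case/andP: (BI al).
  by have /andP[lu uh] := Bint e be; exact: mono.
Qed.

End scalar_law.

(** * The limited method *)

Lemma convex_set_is_convex (R : realType) (V : lmodType R)
    (B : set (convex_lmodType V)) : convex_set B -> is_convex (B : set V).
Proof.
move=> cvxB x y t Bx By t0 t1.
by have := cvxB x y (Itv01 t0 t1); rewrite !inE => /(_ Bx By).
Qed.

(** Collects what the final argument needs from each kind of equation, so that it makes no further
    case distinction. *)
Lemma covered_properties (R : realType) (d m : nat) (M : mesh R d) kd k
    (Q : quadrature M kd k) (bc : bdata M m) (f : flux m) (B : set 'rV[R]_m)
    (L : limiter M m) relevant :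
  covered Q bc f B L relevant -> C1_flux f B ->
  [/\ is_convex B, scaling_limiter Q B L & weak_G Q bc f B relevant].
Proof.
case=> {m bc f B L relevant}.
- move=> bc f lo hi lowM fC1; split.
  + move=> x y t /andP[lx xh] /andP[ly yh] t0 t1.
    by apply/andP; rewrite !mxE; split; nra.
  + exact: scalar_limiter_scaling.
  + exact: scalar_weak_G.
- move=> bc gamma lowM g1 fC1; have cvxB := @euler_region_convex R d gamma g1.
  split; [by []|exact: euler_limiter_scaling|].
  by apply: LF_splitting_weak_G => //; exact: euler_LF_splitting.
- move=> m bc f B L cvxB _ LF limL _; have cvxB' := convex_set_is_convex cvxB.
  by split => //; exact: LF_splitting_weak_G.
Qed.

(** * Evaluation of formal identities in a module *)

Section evaluation.
Context {R : realType} {s : nat} {V : lmodType R} (val : symbol s -> V).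
Implicit Types phi psi : @formal R s.

(** The linear extension of an assignment of vectors to the symbols; it will be used with cell
    averages as the vectors. *)
Definition eval_formal phi : V := \sum_x phi x *: val x.

Lemma eval_formal_linear t phi psi :
  eval_formal (t *: phi + psi) = t *: eval_formal phi + eval_formal psi.
Proof.
rewrite /eval_formal scaler_sumr -big_split; apply: eq_bigr => x _ /=.
by rewrite !ffunE scalerDl scalerA.
Qed.

Lemma eval_formalD phi psi :
  eval_formal (phi + psi) = eval_formal phi + eval_formal psi.
Proof. by rewrite -[phi]scale1r eval_formal_linear !scale1r. Qed.

Lemma eval_formal0 : eval_formal 0 = 0.
Proof. by rewrite /eval_formal big1// => x _; rewrite ffunE scale0r. Qed.

Lemma eval_formalZ t phi : eval_formal (t *: phi) = t *: eval_formal phi.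
Proof. by rewrite -[t *: phi]addr0 eval_formal_linear eval_formal0 addr0. Qed.

Lemma eval_formal_sum (I : Type) (r : seq I) (P : pred I) (phi : I -> @formal R s) :
  eval_formal (\sum_(i <- r | P i) phi i) = \sum_(i <- r | P i) eval_formal (phi i).
Proof. exact: (big_morph _ eval_formalD eval_formal0). Qed.

Lemma eval_formal_sym x : eval_formal (sym x) = val x.
Proof.
rewrite /eval_formal (bigD1 x)//= ffunE eqxx scale1r big1 ?addr0// => y yx.
by rewrite ffunE (negPf yx) scale0r.
Qed.

End evaluation.

Section cRKDG.
Context {R : realType} {d m : nat} {M : mesh R d} {kd : poly_kind} {k : nat}.
Context (Q : quadrature M kd k) (bc : bdata M m) (f : @flux R d m).
Context (B : set 'rV[R]_m) (relevant : dgfun M m -> set 'rV[R]_m) (fhat : num_flux M m).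
Hypothesis Bbc : forall e x w, nbr e = None -> B w -> B (bc e x w).

(** An exterior state is either a nodal value of the neighbouring cell, as matching edges share
    their nodes up to the shift, or boundary data, which preserve [B]. *)
Lemma on_S_on_Sbar (u : dgfun M m) (K : cell M) :
  (forall K, on_S Q B K (u K)) -> on_Sbar Q bc B K u.
Proof.
move=> Bu; split => // e be eK; rewrite /u_ext; case E : (nbr e) => [e'|].
  by have [be' <-] := xE_nbr E be; apply: Bu; exact: nodesE.
by apply: Bbc => //; apply: Bu; exact: nodesE.
Qed.

(** The hypothesis [weak_F] for the time step dt mu: the factor mu passes through [lambda] and turns
    cF / mu into cF. *)
Lemma F_step_average (dt mu a0 cF : R) u w (K : cell M) :
  weak_F Q bc f fhat B relevant a0 cF -> 0 < dt -> 0 < mu -> 0 < a0 ->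
  in_Vh kd k u -> is_F Q bc f fhat u w ->
  ubound (wave_speeds M f (relevant u)) a0 -> lambda M dt * a0 <= cF / mu ->
  (forall K, on_S Q B K (u K)) ->
  B (cavg K (u K) + (dt * mu) *: cavg K (w K)).
Proof.
move=> hF dt0 mu0 a00 uV Fw a0ub cfl Bu.
have wV := is_F_in_Vh Fw.
have := hF (dt * mu) u w (mulr_gt0 dt0 mu0) uV Fw a0ub.
have dtmu : lambda M (dt * mu) * a0 <= cF.
  apply: le_trans (_ : mu * lambda M dt * a0 <= _).
    by rewrite ler_wpM2r ?lambdaZ_le ?ltW.
  by rewrite -mulrA mulrC -ler_pdivlMr.
move=> /(_ dtmu K (on_S_on_Sbar K Bu)).
by rewrite !ffunE addrC (cavg_linear Q)// addrC.
Qed.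

Lemma G_step_average (dt mu a0 t : R) u w (K : cell M) :
  weak_G Q bc f B relevant -> 0 < dt -> 0 < mu -> 0 < a0 -> `|t| = dt * mu ->
  in_Vh kd k u -> is_G Q bc f u w ->
  ubound (wave_speeds M f (relevant u)) a0 -> lambda M dt * a0 <= c_G Q / mu ->
  (forall K, on_S Q B K (u K)) ->
  B (cavg K (u K) + t *: cavg K (w K)).
Proof.
move=> hG dt0 mu0 a00 tE uV Gw a0ub cfl Bu.
have wV := is_G_in_Vh Gw.
rewrite [_ + _]addrC -(cavg_linear Q)// addrC.
apply: (hG t a0 u w) => //; rewrite tE.
apply: le_trans (_ : mu * lambda M dt * a0 <= _).
  by rewrite ler_wpM2r ?lambdaZ_le ?ltW.
by rewrite -mulrA mulrC -ler_pdivlMr.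
Qed.

End cRKDG.

Theorem theorem3p5 (R : realType) (d m : nat) (hd : (0 < d)%N)
    (M : mesh R d) (kd : poly_kind) (k : nat) (hk : (1 <= k)%N)
    (Q : quadrature M kd k) (bc : bdata M m)
    (f : flux m) (B : set 'rV[R]_m) (L : limiter M m)
    (relevant : dgfun M m -> set 'rV[R]_m) (fhat : num_flux M m)
    (s : nat) (hs : (0 < s)%N) (a : 'M[R]_s) (b : 'rV[R]_s)
    (wF wP wM muF muP muM : 'M[R]_(s.+1, s))
    (dt cF a0 : R) (un un1 : dgfun M m) (u ut g F : 'I_s -> dgfun M m)
    (hf : C1_flux f B)
    (hcov : covered Q bc f B L relevant)
    (hbc : forall e x w, nbr e = None -> B w -> B (bc e x w))
    (ha : forall i j : 'I_s, (i <= j)%N -> a i j = 0)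
    (hdt : 0 < dt)
    (hconv : convex_combination a b dt wF wP wM muF muP muM)
    (hmu : positive_steps wF wP wM muF muP muM)
    (ha0 : 0 < a0)
    (ha0max : is_max
       (wave_speeds M f (\bigcup_(i in [set: 'I_s]) relevant (ut i))) a0)
    (hcF : 0 < cF)
    (hF : weak_F Q bc f fhat B relevant a0 cF)
    (hcfl : cfl wF wP wM muF muP muM (lambda M dt * a0) cF (c_G Q))
    (hstep : limited_step Q bc f fhat L dt a b un un1 u ut g F) :
  (forall K, on_S Q B K (un K)) -> forall K, on_S Q B K (un1 K).
Proof.
move=> unB; have [cvxB limL hG] := covered_properties hcov hf.
have [unV uE utL GF un1L] := hstep.
have gV i : in_Vh kd k (g i) by exact: is_G_in_Vh (GF i).1.
have FV i : in_Vh kd k (F i) by exact: is_F_in_Vh (GF i).2.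
have uV i : in_Vh kd k (u i).
  move=> K; rewrite uE ffunE; apply: in_spaceD; first exact: unV.
  rewrite ffunE sum_ffunE; apply/in_spaceZ/in_space_sum => j _.
  by rewrite ffunE; apply: in_spaceZ; exact: gV.
have utV i : in_Vh kd k (ut i).
  by move=> K; have [] := limL K _ _ (uV i K) (utL i K).
have avg_ut i K : cavg K (ut i K) = cavg K (u i K).
  by have [] := limL K _ _ (uV i K) (utL i K).
pose w : dgfun M m := un + dt *: \sum_i b 0 i *: F i.
have wV : in_Vh kd k w.
  move=> K; rewrite ffunE; apply: in_spaceD; first exact: unV.
  rewrite ffunE sum_ffunE; apply/in_spaceZ/in_space_sum => j _.
  by rewrite ffunE; apply: in_spaceZ; exact: FV.
have speed j : ubound (wave_speeds M f (relevant (ut j))) a0.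
  move=> r [e [v [lam [rv ev ->]]]]; apply: ha0max.2; exists e, v, lam.
  by split => //; exists j.
pose val K (x : symbol s) : 'rV[R]_m := match x with
  | inl _ => cavg K (un K)
  | inr (inl j) => cavg K (g j K)
  | inr (inr j) => cavg K (F j K) end.
(* The operators are taken at the limited stages, yet the formula of a stage yields the average of
   the stage before limiting. *)
have avg_inner i K : eval_formal (val K) (inner_stage a dt i) = cavg K (u i K).
  rewrite eval_formalD eval_formal_sym eval_formalZ eval_formal_sum uE !ffunE sum_ffunE.
  rewrite (cavgD Q); [|exact: unV|]; last first.
    by apply/in_spaceZ/in_space_sum => j _; rewrite ffunE; apply/in_spaceZ/gV.
  rewrite (cavgZ Q); last by apply/in_space_sum => j _; rewrite ffunE; apply/in_spaceZ/gV.
  rewrite (cavg_sum Q); last by move=> j _; rewrite ffunE; apply/in_spaceZ/gV.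
  congr (_ + _ *: _); apply: eq_bigr => j _.
  by rewrite eval_formalZ eval_formal_sym ffunE (cavgZ Q)//; exact: gV.
have avg_final K : eval_formal (val K) (final_stage b dt) = cavg K (w K).
  rewrite eval_formalD eval_formal_sym eval_formalZ eval_formal_sum !ffunE sum_ffunE.
  rewrite (cavgD Q); [|exact: unV|]; last first.
    by apply/in_spaceZ/in_space_sum => j _; rewrite ffunE; apply/in_spaceZ/FV.
  rewrite (cavgZ Q); last by apply/in_space_sum => j _; rewrite ffunE; apply/in_spaceZ/FV.
  rewrite (cavg_sum Q); last by move=> j _; rewrite ffunE; apply/in_spaceZ/FV.
  congr (_ + _ *: _); apply: eq_bigr => j _.
  by rewrite eval_formalZ eval_formal_sym ffunE (cavgZ Q)//; exact: FV.
have stage_avg (i : 'I_s.+1) K : (0 < i)%N ->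
    (forall j : 'I_s, (j < i)%N -> forall K, on_S Q B K (ut j K)) ->
    B (eval_formal (val K) (stage a b dt i)).
  move=> i0 Bj; have [w0 w1 ->] := hconv i i0.
  have [muF0 muP0 muM0] := hmu; have [cflF cflP cflM] := hcfl.
  apply: cone1; rewrite -w1 eval_formal_sum; apply: cone_sum => // j ji.
  have [wF0 wP0 wM0] := w0 j; have {}Bj := Bj j ji.
  (* Here the limiter enters: it keeps averages, so the formal stage j evaluates to the average of
     the limited stage [ut j], at which the operators were computed and whose nodal values are in
     [B]. *)
  have := avg_inner j K; rewrite -avg_ut; move: (inner_stage a dt j) => I avgI.
  rewrite !eval_formalD !eval_formalZ -scaleNr !eval_formalD !eval_formalZ.
  rewrite !eval_formal_sym avgI.
  apply: coneD => //; first apply: coneD => //; apply: coneP => // wpos.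
  - apply: (F_step_average hbc K hF hdt (muF0 i j ji wpos) ha0 (utV j) (GF j).2) => //.
    exact: cflF.
  - have mu0 := muP0 i j ji wpos.
    apply: (G_step_average K hG hdt mu0 ha0 _ (utV j) (GF j).1) => //.
      by rewrite ger0_norm// mulr_ge0 ?ltW.
    exact: cflP.
  - have mu0 := muM0 i j ji wpos.
    apply: (G_step_average K hG hdt mu0 ha0 _ (utV j) (GF j).1) => //.
      by rewrite normrN ger0_norm// mulr_ge0 ?ltW.
    exact: cflM.
(* Strong induction on the stage number, in bounded form. *)
have utB n : forall i : 'I_s, (i < n)%N -> forall K, on_S Q B K (ut i K).
  elim: n => // n IH i; rewrite ltnS => ilen K.
  have [_ _] := limL K _ _ (uV i K) (utL i K); apply.
  (* Stage 0 has an empty sum and equals [un]; the convex combinations start with stage 1. *)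
  have [i0|i0] := posnP i.
    rewrite uE big1 ?scaler0 ?addr0; last by move=> j; rewrite i0.
    exact: on_S_cavg (unV K) (unB K).
  (* Among the s + 1 stages, [lift ord_max i] is the inner stage with the same number i. *)
  rewrite -avg_inner; have := stage_avg (lift ord_max i) K.
  rewrite /stage liftK lift_max; apply => // j ji.
  by apply: IH; exact: leq_trans ji ilen.
move=> K; have [_ _] := limL K _ _ (wV K) (un1L K); apply.
rewrite -avg_final; have := stage_avg ord_max K.
by rewrite /stage unlift_none /=; apply => // j js; exact: utB js.
Qed.
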